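(* There exist a finitely generated residually finite group $G$ and a box space $(Y_n)_{n\in\mathbb{N}}$ of $G$ such that: (a) $(Y_n)_{n\in\mathbb{N}}$ does not coarsely embed into any $L^p$-space for any $1\leqslant p<\infty$; (b) $(Y_n)_{n\in\mathbb{N}}$ does not coarsely embed into any uniformly curved Banach space; and yet (c) $(Y_n)_{n\in\mathbb{N}}$ does not admit any weakly embedded expander.
   Context: Box space: let $G$ be a finitely generated residually finite group, $S$ a finite generating subset, and $G=N_0\trianglerighteq N_1\trianglerighteq\cdots$ a nested sequence of finite index normal subgroups of $G$ with $\bigcap_n N_n=\{e\}$. The associated box space is the sequence of Cayley graphs $(G/N_n,d_{S_n})$, where $S_n$ is the image of $S$ in $G/N_n$ and $d_{S_n}$ is the word metric. It can equivalently be viewed as a single metric space, the disjoint union of the $G/N_n$ with a metric restricting to $d_{S_n}$ on each piece and such that the distance between the $n$-th and the $m$-th pieces ($m\ne n$) tends to infinity as $\max\{n,m\}\to\infty$. Coarse embedding: a sequence of maps $\phi_n\colon X_n\to Y$ from metric spaces $(X_n,d_n)$ to a metric space $(Y,d_Y)$ is a coarse embedding of $(X_n)$ into $Y$ if there are two proper functions $\rho,\gamma\colon[0,\infty)\to[0,\infty)$ (independent of $n$) with $\rho(d_n(x,y))\leqslant d_Y(\phi_n(x),\phi_n(y))\leqslant\gamma(d_n(x,y))$ for all $n$ and all $x,y\in X_n$. Expander: for a finite connected graph $X$ and a set $A$ of vertices, $\partial A$ is the set of edges between $A$ and $X\setminus A$, and $h(X)=\min_{1\leqslant|A|\leqslant|X|/2}|\partial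 A|/|A|$. An expander is a sequence $(X_n)$ of finite connected graphs with uniformly bounded degree, $|X_n|\to\infty$, and $h(X_n)\geqslant c$ for all $n$ for some constant $c>0$. Weak embedding: a sequence of maps $\phi_n\colon X_n\to Y$ from finite metric spaces to a metric space $Y$ is a weak embedding if there is $K>0$ such that all $\phi_n$ are $K$-Lipschitz and for all $R>0$, $\lim_{n\to\infty}\sup_{x\in X_n}|\phi_n^{-1}(B(\phi_n(x),R))|/|X_n|=0$. A box space admits a weakly embedded expander if there is an expander (with graph metrics) that weakly embeds into the box space viewed as a single metric space. $L^p$-space: a Banach space $L^p(\Omega,\nu)$ for some measure space $(\Omega,\nu)$. Uniformly curved Banach space: a Banach space $X$ for which there is a function $\varepsilon\mapsto\Delta_X(\varepsilon)$ tending to $0$ as $\varepsilon\to0^+$ such that, for every measure space $(\Omega,\mu)$, every operator $T\colon L^2(\Omega,\mu)\to L^2(\Omega,\mu)$ with $\|T\|\leqslant\varepsilon$ that is simultaneously of norm $\leqslant1$ on $L^1$ and on $L^\infty$ has norm $\leqslant\Delta_X(\varepsilon)$ on $L^2(\Omega,\mu,X)$, the Banach space of square-summable measurable functions $\Omega\to X$. *)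

(* Defs.v *)
From HB Require Import structures.
From mathcomp Require Import all_boot all_order all_algebra.
From mathcomp Require Import all_classical all_reals all_analysis.

Set Implicit Arguments.
Unset Strict Implicit.
Unset Printing Implicit Defensive.

Import Order.TTheory GRing.Theory Num.Theory.
Import numFieldNormedType.Exports.

Local Open Scope classical_set_scope.
Local Open Scope ring_scope.

(* Only ever used on nonempty sets; the value on the empty set is 0. *)
Definition least (P : set nat) : nat :=
  xget 0%N [set n | P n /\ forall m, P m -> (n <= m)%N].

Section Groups.
Local Open Scope group_scope.

Record normal_subgroup (G : groupType) := NormalSubgroup {
  nsub_pred :> {pred G} ;
  nsub_group : group_closed nsub_pred ;
  nsub_conj : forall x y : G, x \in nsub_pred -> x ^ y \in nsub_pred }.

Section Quotient.
Variables (G : groupType) (N : normal_subgroup G).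
Implicit Types x y z : G.

Definition coset_rel : rel G := fun x y => x^-1 * y \in N.

Let nsub1 : 1 \in N. Proof. by case: (nsub_group N). Qed.

Let nsubV x : x \in N -> x^-1 \in N.
Proof. by move=> xN; exact: (group_closedV (nsub_group N)). Qed.

Let nsubM x y : x \in N -> y \in N -> x * y \in N.
Proof. by move=> xN yN; exact: (group_closedM (nsub_group N)). Qed.

Lemma coset_rel_refl : reflexive coset_rel.
Proof. by move=> x; rewrite /coset_rel mulVg. Qed.

Lemma coset_rel_sym : symmetric coset_rel.
Proof.
suff sub x y : coset_rel x y -> coset_rel y x by move=> x y; apply/idP/idP => /sub.
by move=> /nsubV; rewrite /coset_rel invgM invgK.
Qed.

Lemma coset_rel_trans : transitive coset_rel.
Proof. by move=> y x z xy yz; have := nsubM xy yz; rewrite mulgA mulgK. Qed.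

Canonical coset_rel_equiv :=
  EquivRel coset_rel coset_rel_refl coset_rel_sym coset_rel_trans.

Definition quotient_group : Type := {eq_quot coset_rel}%qT.
HB.instance Definition _ := Choice.on quotient_group.
HB.instance Definition _ := EqQuotient.on quotient_group.

Definition quot_proj (x : G) : quotient_group := (\pi_quotient_group x)%qT.

Lemma quot_projP x y : quot_proj x = quot_proj y <-> x^-1 * y \in N.
Proof. by split => [/eqmodP//|xy]; exact/eqmodP. Qed.

Lemma quot_proj_repr (a : quotient_group) : quot_proj (repr a) = a.
Proof. exact: reprK. Qed.

Definition quot_one : quotient_group := quot_proj 1.
Definition quot_mul (a b : quotient_group) := quot_proj (repr a * repr b).
Definition quot_inv (a : quotient_group) := quot_proj (repr a)^-1.

Lemma quot_mulE x y : quot_mul (quot_proj x) (quot_proj y) = quot_proj (x * y).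
Proof.
apply/quot_projP; set x' := repr _; set y' := repr _.
have x'x : x'^-1 * x \in N by apply/quot_projP; rewrite quot_proj_repr.
have y'y : y'^-1 * y \in N by apply/quot_projP; rewrite quot_proj_repr.
have -> : (x' * y')^-1 * (x * y) = (x'^-1 * x) ^ y' * (y'^-1 * y).
  by rewrite invgM /conjg !mulgA mulgK.
by apply: nsubM => //; exact: nsub_conj.
Qed.

Lemma quot_invE x : quot_inv (quot_proj x) = quot_proj x^-1.
Proof.
apply/quot_projP; set x' := repr _; rewrite invgK.
have xx' : x^-1 * x' \in N by apply/quot_projP; rewrite quot_proj_repr.
have -> : x' * x^-1 = (x^-1 * x') ^ x^-1.
  by rewrite /conjg invgK !mulgA mulgV mul1g.
exact: nsub_conj.
Qed.

Let quotW (P : quotient_group -> Prop) :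
  (forall x, P (quot_proj x)) -> forall a, P a.
Proof. by move=> PN a; rewrite -(quot_proj_repr a). Qed.

Lemma quot_mulA : associative quot_mul.
Proof.
elim/quotW => x; elim/quotW => y; elim/quotW => z.
by rewrite !quot_mulE mulgA.
Qed.

Lemma quot_mul1 : left_id quot_one quot_mul.
Proof. by elim/quotW => x; rewrite quot_mulE mul1g. Qed.

Lemma quot_mulr1 : right_id quot_one quot_mul.
Proof. by elim/quotW => x; rewrite quot_mulE mulg1. Qed.

Lemma quot_mulV : left_inverse quot_one quot_inv quot_mul.
Proof. by elim/quotW => x; rewrite quot_invE quot_mulE mulVg. Qed.

Lemma quot_mulrV : right_inverse quot_one quot_inv quot_mul.
Proof. by elim/quotW => x; rewrite quot_invE quot_mulE mulgV. Qed.

HB.instance Definition _ := isGroup.Build quotient_group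
  quot_mulA quot_mul1 quot_mulr1 quot_mulV quot_mulrV.

End Quotient.

Definition finite_index (G : groupType) (N : normal_subgroup G) : Prop :=
  finite_set [set: quotient_group N].

Definition word_in (G : groupType) (S : set G) (w : seq G) : Prop :=
  forall s, s \in w -> S s \/ S s^-1.

Definition generates (G : groupType) (S : set G) : Prop :=
  forall x : G, exists2 w, word_in S w & x = \prod_(s <- w) s.

Definition word_dist (G : groupType) (S : set G) (x y : G) : nat :=
  least [set k | exists w : seq G,
    [/\ word_in S w, size w = k & x^-1 * y = \prod_(s <- w) s]].

Definition finitely_generated (G : groupType) : Prop :=
  exists2 S : set G, finite_set S & generates S.

Definition residually_finite (G : groupType) : Prop :=
  forall x : G, x != 1 ->
    exists2 N : normal_subgroup G, finite_index N & x \notin N.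

Record box_space (G : groupType) := BoxSpace {
  box_gen : set G ;
  box_chain : nat -> normal_subgroup G ;
  box_gen_finite : finite_set box_gen ;
  box_gen_generates : generates box_gen ;
  box_chain0 : forall x, x \in box_chain 0 ;
  box_chainS : forall n, {subset box_chain n.+1 <= box_chain n} ;
  box_chain_index : forall n, finite_index (box_chain n) ;
  box_chain_cap : forall x, (forall n, x \in box_chain n) -> x = 1 }.

End Groups.

Section BoxSpaceMetric.
Variables (R : realType) (G : groupType) (Y : box_space G).

Definition box_piece (n : nat) : Type := quotient_group (box_chain Y n).

Definition box_dist (n : nat) (x y : box_piece n) : R :=
  (word_dist (quot_proj (box_chain Y n) @` box_gen Y) x y)%:R.

Definition is_metric (M : Type) (d : M -> M -> R) : Prop :=
  [/\ forall x y, d x y = 0 <-> x = y,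
      forall x y, d x y = d y x &
      forall x y z, d x z <= d x y + d y z].

Definition box_union : Type := {n : nat & box_piece n}.

Definition box_union_metric (d : box_union -> box_union -> R) : Prop :=
  [/\ is_metric d,
      forall n (x y : box_piece n),
        d (existT _ n x) (existT _ n y) = box_dist x y &
      forall M : R, exists n0 : nat, forall n m : nat,
        n != m -> (n0 <= maxn n m)%N ->
        forall (x : box_piece n) (y : box_piece m),
          M <= d (existT _ n x) (existT _ m y)].

End BoxSpaceMetric.

Section CoarseEmbedding.
Variable R : realType.

(* For possibly discontinuous functions, being proper means that preimages of
   bounded sets are bounded. The values of f at negative reals are irrelevant. *)
Definition proper_halfline (f : R -> R) : Prop :=
  (forall t, 0 <= t -> 0 <= f t) /\
  forall B : set R, bounded_set B -> bounded_set [set t | 0 <= t /\ B (f t)].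

Definition coarse_embedding (X : nat -> Type) (dX : forall n, X n -> X n -> R)
    (Y : Type) (dY : Y -> Y -> R) (phi : forall n, X n -> Y) : Prop :=
  exists rho gamma : R -> R,
    [/\ proper_halfline rho, proper_halfline gamma &
        forall n (x y : X n),
          rho (dX n x y) <= dY (phi n x) (phi n y) <= gamma (dX n x y)].

Definition coarsely_embeds (X : nat -> Type) (dX : forall n, X n -> X n -> R)
    (Y : Type) (dY : Y -> Y -> R) : Prop :=
  exists phi : forall n, X n -> Y, coarse_embedding dX dY phi.

End CoarseEmbedding.

Section Expanders.

Record graph := Graph {
  vertex :> finType ;
  adj : rel vertex ;
  adj_sym : symmetric adj ;
  adj_irr : irreflexive adj }.

Definition connected_graph (X : graph) : Prop :=
  (0 < #|X|)%N /\ forall x y : X, connect (@adj X) x y.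

Definition graph_dist (X : graph) (x y : X) : nat :=
  least [set k | exists p : seq X,
    [/\ path (@adj X) x p, last x p = y & size p = k]].

(* Each edge leaving A is counted once, oriented from A to its complement. *)
Definition edge_boundary (X : graph) (A : {set X}) : {set X * X} :=
  [set u | [&& u.1 \in A, u.2 \notin A & adj u.1 u.2]]%SET.

(* The minimum over the empty family, which occurs only when #|X| <= 1,
   is +oo. *)
Definition cheeger (R : realType) (X : graph) : \bar R :=
  (\big[Order.min/+oo]_(A : {set X} | (1 <= #|A|)%N && (#|A|.*2 <= #|X|)%N)
     (#|edge_boundary A|%:R / #|A|%:R)%:E)%E.

Definition expander (R : realType) (X : nat -> graph) : Prop :=
  [/\ forall n, connected_graph (X n),
      exists D : nat, forall n (x : X n), (#|[set y | adj x y]%SET| <= D)%N,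
      (fun n => #|X n|) @ \oo --> \oo &
      exists2 c : R, 0 < c & forall n, (c%:E <= cheeger R (X n))%E].

Definition weak_embedding (R : realType) (X : nat -> finType)
    (dX : forall n, X n -> X n -> R) (Y : Type) (dY : Y -> Y -> R)
    (phi : forall n, X n -> Y) : Prop :=
  (exists2 K : R, 0 < K &
     forall n (x y : X n), dY (phi n x) (phi n y) <= K * dX n x y) /\
  forall r : R, 0 < r ->
    (fun n => \big[Order.max/0]_(x : X n)
       (#|[set y | dY (phi n x) (phi n y) < r]%SET|%:R / #|X n|%:R : R))
      @ \oo --> (0 : R).

Definition admits_weakly_embedded_expander (R : realType) (G : groupType)
    (Y : box_space G) : Prop :=
  exists2 d : box_union Y -> box_union Y -> R, box_union_metric d &
  exists2 X : nat -> graph, expander R X &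
  exists phi : forall n, X n -> box_union Y,
    weak_embedding (fun n (x y : X n) => (graph_dist x y)%:R) d phi.

End Expanders.

Section UniformlyCurved.
Variable R : realType.

Definition Lp_dist d (Om : measurableType d) (mu : {measure set Om -> \bar R})
    (p : \bar R) (p1 : (1 <= p)%E) (f g : LspaceType mu p1) : R :=
  fine 'N[mu]_p[(fun t => ((f : Om -> R) t - (g : Om -> R) t)%:E)]%E.

Definition norm_dist (X : normedModType R) (x y : X) : R := `|x - y|.

Section ScalarOperators.
Context d (Om : measurableType d) (mu : {measure set Om -> \bar R}).

Let L2 := LfunType mu (lee1n 2).

(* An operator on L^2 is given on representatives, and is linear up to
   a.e. equality; that it respects a.e. equality follows from boundedness. *)
Definition ae_linear (T : L2 -> L2) : Prop :=
  forall (a : R) (f g : L2), {ae mu, forall t,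
    T (a *: f + g) t = a * T f t + T g t}.

(* For p <> 2 this only constrains T on those f in L^2 whose p-norm is finite,
   as long as c > 0. *)
Definition Lp_bounded (p : \bar R) (c : R) (T : L2 -> L2) : Prop :=
  forall f : L2, ('N[mu]_p[EFin \o T f] <= c%:E * 'N[mu]_p[EFin \o f])%E.

End ScalarOperators.

Section VectorValued.
Context d (Om : measurableType d) (mu : {measure set Om -> \bar R}).
Variable X : completeNormedModType R.

Definition strongly_measurable (F : Om -> X) : Prop :=
  exists s : nat -> Om -> X,
    [/\ forall k, finite_set (range (s k)),
        forall k v, measurable (s k @^-1` [set v]) &
        forall t, s k t @[k --> \oo] --> F t].

Definition bochner_norm2 (F : Om -> X) : \bar R :=
  ('N[mu]_2[(fun t => `|F t|%:E)])%E.

Definition bochner_L2 (F : Om -> X) : Prop :=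
  strongly_measurable F /\ (bochner_norm2 F < +oo)%E.

(* T extends to an operator of norm at most c on L^2(Om, mu, X), namely the
   unique bounded operator that is T (x) id_X on elementary tensors. *)
Definition bochner_bounded (c : R)
    (T : LfunType mu (lee1n 2) -> LfunType mu (lee1n 2)) : Prop :=
  exists TX : (Om -> X) -> (Om -> X),
    [/\ forall F, bochner_L2 F -> bochner_L2 (TX F),
        forall (a : R) F H, bochner_L2 F -> bochner_L2 H ->
          {ae mu, forall t, TX (fun s => a *: F s + H s) t
                            = a *: TX F t + TX H t},
        forall (f : LfunType mu (lee1n 2)) (v : X),
          {ae mu, forall t, TX (fun s => f s *: v) t = T f t *: v} &
        forall F, bochner_L2 F ->
          (bochner_norm2 (TX F) <= c%:E * bochner_norm2 F)%E].

End VectorValued.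

(* Scalars are real. A uniformly curved complex Banach space is also uniformly
   curved as a real one, since a real operator that is contractive on L^1 and
   L^oo has a complexification with the same three norms. *)
Definition uniformly_curved (X : completeNormedModType R) : Prop :=
  exists2 Delta : R -> R, Delta e @[e --> 0^'+] --> (0 : R) &
    forall e : R, 0 < e ->
    forall (d : measure_display) (Om : measurableType d)
      (mu : {measure set Om -> \bar R})
      (T : LfunType mu (lee1n 2) -> LfunType mu (lee1n 2)),
      ae_linear T -> Lp_bounded 2%E e T ->
      Lp_bounded 1%E 1 T -> Lp_bounded +oo%E 1 T ->
      bochner_bounded X (Delta e) T.

End UniformlyCurved.

(* Main.v *)
Require Import Defs.
From HB Require Import structures.
From mathcomp Require Import all_boot all_order all_algebra all_fingroup cyclic.
From mathcomp Require Import ring lra.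
Set Implicit Arguments.
Unset Strict Implicit.
Unset Printing Implicit Defensive.
Import Order.TTheory GRing.Theory Num.Theory.
Local Open Scope ring_scope.

(** The pieces of the box space are extensions of a finite group by an
    elementary abelian 2-group in which a large subgroup is expanding relative
    to the whole piece, although no expander can hide in it.

    Let [A] be the plane over F2[t]/(t^n), let three unipotent involutions with
    entries 1 and t act on it, and let [P] be the group of permutations of [A].
    A level consists of an affine permutation of [A], its linear part in [P],
    and a function on the edges of the Cayley graph of [P], which records the
    parity of the number of crossings of each edge by the walk that a word
    describes. The group of the theorem is the group of words in five
    generators, the three moves and two translations, modulo equality in all
    levels; its box space has the subgroups of the levels generated by these
    five elements for pieces. That the kernels are nested holds because both
    truncation modulo t^n and summing parities over the fibres of a reduction
    commute with the generators ([level_nested]).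

    Relative expansion ([relative_gap]). Decompose a function on a level along
    the characters of the group of translations. The squared norms of the
    components are weights on the dual plane; if the function varies little
    under the generators, the weights are almost invariant under the dual moves
    and almost carried by pairs with two coordinates of positive valuation, on
    which the ultrametric norm makes the moves play ping-pong. Hence a function with zero
    mean on the cosets of the translations is controlled in square norm by its
    variation along the generators, uniformly in the level. Indicator functions
    and layer-cake decomposition give the same for the sum of absolute values
    ([gap_L1]), and Matousek's extrapolation gives it for all exponents at
    least 1 ([gap_Lp]).

    No coarse embedding. If a map from a piece is Lipschitz, the gap bounds the
    mean distance between the images of a point and of its translates. But
    there are more and more translations, while a ball of given radius in a
    piece has bounded cardinality ([not_coarsely_embeds]). For Lebesgue spaces,
    the gap is applied pointwise and integrated. For uniformly curved spaces,
    half of a power of the averaging operator composed with centring is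
    contracting on L1 and Loo and of small norm on L2, so that it is of small
    norm on vector-valued functions; a centred function close to its own average is
    then small ([curved_smoothing]).

    No weakly embedded expander ([expander_fibre]). Each edge of the Cayley
    graph of [P] gives a wall, that is, a cut of the piece by the parity of its
    crossings. Expansion bounds the mean number of walls between two vertices
    of an expander that is mapped into the piece. An edge set of boundary
    {p, q} contains a path from [p] to [q], so the number of walls dominates
    the distance of the linear parts, and a positive proportion of the expander
    has one and the same linear part ([linear_concentration]). The elements of
    the piece with trivial linear part form an elementary abelian 2-group, so
    those of bounded length generate a subgroup of bounded order; its cosets
    are far apart, and an expander cannot be spread over several of them. A
    positive proportion of the expander is therefore sent to a single point. *)

(** * Groups of walks recorded by the parity of their crossings *)

Lemma addbool_self (b : bool) : b + b = 0.
Proof. by case: b. Qed.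

Section ParityGroup.
Variables (P : finGroupType) (S : finType).

(** The wreath product of F2^S by the regular action of [P]; its
    first component is read as an F2-chain on the edges of a Cayley graph. *)
Definition parity_group : Type := ({ffun P * S -> bool} * P)%type.
HB.instance Definition _ := Finite.on parity_group.

Implicit Types g h k : parity_group.

Definition parity_shift (p : P) (f : {ffun P * S -> bool}) : {ffun P * S -> bool} :=
  [ffun e => f ((p^-1 * e.1)%g, e.2)].

Definition parity_mul g h : parity_group :=
  (g.1 + parity_shift g.2 h.1, (g.2 * h.2)%g).

Definition parity_one : parity_group := (0, 1%g).

Definition parity_inv g : parity_group := (parity_shift g.2^-1 g.1, g.2^-1%g).

Lemma parity_mulA : associative parity_mul.
Proof.
move=> g h k; rewrite /parity_mul /= mulgA; congr pair.
by apply/ffunP => e; rewrite !ffunE /= invMg -mulgA addrA.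
Qed.

Lemma parity_mul1 : left_id parity_one parity_mul.
Proof.
case=> f p; rewrite /parity_mul /= mul1g; congr pair.
by apply/ffunP => -[q s]; rewrite !ffunE /= invg1 mul1g add0r.
Qed.

Lemma parity_mulV : left_inverse parity_one parity_inv parity_mul.
Proof.
case=> f p; rewrite /parity_mul /= mulVg; congr pair.
by apply/ffunP => -[q s]; rewrite !ffunE /= addbool_self.
Qed.

HB.instance Definition _ := Finite_isGroup.Build parity_group
  parity_mulA parity_mul1 parity_mulV.

Lemma parity_mulE g h : (g * h)%g = (g.1 + parity_shift g.2 h.1, (g.2 * h.2)%g).
Proof. by []. Qed.

Section Walks.
Variable p : S -> P.
Hypothesis pp : forall s, (p s * p s = 1)%g.
Implicit Types (q r : P) (s : S) (f : {ffun P * S -> bool}).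

Let mulpp q s : (q * p s * p s)%g = q.
Proof. by rewrite -mulgA pp mulg1. Qed.

Let eqpp q r s : (q * p s == r)%g = (q == r * p s)%g.
Proof. by rewrite -{1}(mulpp r s); apply/eqP/eqP => [/mulIg|->]. Qed.

(** The edge joining [q] to [q * p s] has the two names [(q, s)] and
    [(q * p s, s)]; toggling both of them makes a loop count for nothing. *)
Definition crossing q s : {ffun P * S -> bool} :=
  [ffun e => (e == (q, s)) + (e == ((q * p s)%g, s))].

Definition walk s : parity_group := (crossing 1 s, p s).

Lemma mul_walk g s : (g * walk s)%g = (g.1 + crossing g.2 s, (g.2 * p s)%g).
Proof.
rewrite parity_mulE; congr (_ + _, _); apply/ffunP => -[q t]; rewrite !ffunE /=.
rewrite !xpair_eqE -![(_^-1 * q == _)%g](inj_eq (mulgI g.2)) mulKVg mulg1.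
by rewrite mul1g.
Qed.

Lemma walkK s : (walk s * walk s = 1)%g.
Proof.
rewrite mul_walk /= pp; congr (_, _); apply/ffunP => -[q t].
rewrite !ffunE /= mul1g pp.
by case: (_ == _); case: (_ == _).
Qed.

(** The chains in which both names of an edge have the same coefficient and
    loops have none; all chains of walks from the identity are such. *)
Definition edge_parity f :=
  [/\ forall q s, f ((q * p s)%g, s) = f (q, s)
    & forall q s, f (q, s) -> (q * p s)%g != q].

Definition boundary f q : bool := \sum_s f (q, s).

Lemma edge_parityD f1 f2 :
  edge_parity f1 -> edge_parity f2 -> edge_parity (f1 + f2).
Proof.
move=> [sym1 loop1] [sym2 loop2]; split => q s; rewrite !ffunE ?sym1 ?sym2 //.
by have := loop1 q s; have := loop2 q s; do 2!case: (f1 _); do 2!case: (f2 _); auto.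
Qed.

Lemma edge_parity_crossing q s : edge_parity (crossing q s).
Proof.
split=> r t; rewrite !ffunE !xpair_eqE.
  case: (eqVneq t s) => [->|_]; rewrite ?andbF // !andbT addrC.
  by rewrite !eqpp mulpp.
case: (eqVneq t s) => [->|_]; rewrite ?andbF // !andbT.
apply: contraTneq => rs; rewrite -{1}rs eqpp.
by case: (_ == _).
Qed.

Lemma boundaryD f1 f2 q : boundary (f1 + f2) q = boundary f1 q + boundary f2 q.
Proof. by rewrite -big_split; apply: eq_bigr => s _; rewrite ffunE. Qed.

Lemma boundary_crossing q s r :
  boundary (crossing q s) r = (r == q) + (r == q * p s)%g.
Proof.
rewrite /boundary (bigD1 s)//= big1 ?addr0 => [|t ts].
  by rewrite ffunE !xpair_eqE eqxx !andbT.
by rewrite ffunE !xpair_eqE (negPf ts) !andbF.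
Qed.

(** A path is extracted one edge at a time: a vertex of odd boundary other
    than the end has an edge, and deleting that edge moves the boundary along
    it. *)
Lemma boundary_path f q r :
  edge_parity f -> (forall z, boundary f z = (z == q) + (z == r)) ->
  exists2 w : seq S, (size w <= #|[set e | f e]|)%N & r = (q * \prod_(s <- w) p s)%g.
Proof.
have [m] := ubnP #|[set e | f e]|; elim: m f q => // m IHm f q fm fE fB.
have [->|qr] := eqVneq r q; first by exists [::]; rewrite ?big_nil ?mulg1.
have /existsP[s fqs] : [exists s, f (q, s)].
  apply: contraT => /existsPn f0.
  have := fB q; rewrite /boundary big1 => [|s _]; last exact: negbTE.
  by rewrite eqxx eq_sym (negPf qr).
have qsq := fE.2 q s fqs.
have sub : [set e | (f + crossing q s) e] \proper [set e | f e].
  apply/properP; split.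
    apply/subsetP => -[z t]; rewrite !inE !ffunE.
    case: eqP => [->|_]; first by rewrite fqs.
    by case: eqP => [->|_]; [rewrite fE.1 fqs|case: (f _)].
  by exists (q, s); rewrite !inE // !ffunE fqs eqxx xpair_eqE eq_sym (negPf qsq).
have fm' : (#|[set e | (f + crossing q s)%R e]| < m)%N.
  by rewrite (leq_trans (proper_card sub)).
have [|z|w wm ->] := IHm _ (q * p s)%g fm'.
- by apply: edge_parityD => //; exact: edge_parity_crossing.
- rewrite boundaryD fB boundary_crossing.
  by case: (_ == q); case: (_ == r); case: (_ == _).
exists (s :: w) => /=; last by rewrite big_cons mulgA.
exact: leq_ltn_trans wm (proper_card sub).
Qed.

End Walks.
End ParityGroup.

(** * The finite groups of the construction *)

Definition move : finType := option bool.
Definition generator : finType := (move + bool)%type.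

(** On rows, multiplication by the variable in F2[t]/(t^n); on columns, its
    transpose. *)
Definition shift n : 'M[bool]_n := \matrix_(i, j) (i.+1 == j :> nat).

Section Plane.
Variable n : nat.

Definition plane : Type := ('rV[bool]_n * 'rV[bool]_n)%type.
HB.instance Definition _ := Finite.on plane.
HB.instance Definition _ := GRing.Zmodule.on plane.
Definition dual : Type := ('cV[bool]_n * 'cV[bool]_n)%type.
HB.instance Definition _ := Finite.on dual.
HB.instance Definition _ := GRing.Zmodule.on dual.

Definition pairing (a : plane) (x : dual) : bool := (a.1 *m x.1 + a.2 *m x.2) 0 0.

(** Elementary matrices of order 2 with entries t and 1. *)
Definition act (s : move) (a : plane) : plane :=
  match s with
  | Some true => (a.1, a.2 + a.1 *m shift n)
  | Some false => (a.1 + a.2 *m shift n, a.2)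
  | None => (a.1, a.2 + a.1)
  end.

(** The transposed matrices, in the coordinates of the dual. *)
Definition coact (s : move) (x : dual) : dual :=
  match s with
  | Some true => (x.1 + shift n *m x.2, x.2)
  | Some false => (x.1, x.2 + shift n *m x.1)
  | None => (x.1 + x.2, x.2)
  end.

Lemma mx_addbb m1 m2 (B : 'M[bool]_(m1, m2)) : B + B = 0.
Proof. by apply/matrixP => i j; rewrite !mxE addbool_self. Qed.

Lemma plane_addbb (a : plane) : a + a = 0.
Proof. by case: a => a b; congr (_, _); exact: mx_addbb. Qed.

Lemma actK s : involutive (act s).
Proof. by case: s => [[]|] [a b] /=; rewrite -addrA mx_addbb addr0. Qed.

Lemma coactK s : involutive (coact s).
Proof. by case: s => [[]|] [a b] /=; rewrite -addrA mx_addbb addr0. Qed.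

Lemma actD s a b : act s (a + b) = act s a + act s b.
Proof.
by case: s => [[]|]; case: a => a a'; case: b => b b'; congr (_, _);
  rewrite /= ?mulmxDl addrACA.
Qed.

Lemma pairing_act s a x : pairing (act s a) x = pairing a (coact s x).
Proof.
by case: s => [[]|] /=; rewrite /pairing /=; congr (fun_of_matrix _ 0 0);
  rewrite ?mulmxDl ?mulmxDr ?mulmxA -?addrA; congr (_ + _); rewrite addrC.
Qed.

Lemma pairingDl a b x : pairing (a + b) x = pairing a x + pairing b x.
Proof. by rewrite /pairing /= !mulmxDl !mxE addrACA. Qed.

Lemma pairingDr a x y : pairing a (x + y) = pairing a x + pairing a y.
Proof. by rewrite /pairing /= !mulmxDr !mxE addrACA. Qed.

Lemma pairing_separates a : a != 0 -> exists x, pairing a x.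
Proof.
case: a => a b; rewrite xpair_eqE negb_and => /orP[/rV0Pn|/rV0Pn] [i ai].
  exists (delta_mx i 0, 0); rewrite /pairing /= mulmx0 addr0 mxE (bigD1 i)//= big1.
    by rewrite mxE !eqxx mulr1 addr0; case: (a 0 i) ai.
  by move=> j ji; rewrite mxE (negPf ji) mulr0.
exists (0, delta_mx i 0); rewrite /pairing /= mulmx0 add0r mxE (bigD1 i)//= big1.
  by rewrite mxE !eqxx mulr1 addr0; case: (b 0 i) ai.
by move=> j ji; rewrite mxE (negPf ji) mulr0.
Qed.

Definition corner : 'rV[bool]_n := \row_i (i == 0%N :> nat).

Definition base (b : bool) : plane := if b then (corner, 0) else (0, corner).

Definition move_perm s : {perm plane} := perm (can_inj (actK s)).
Definition translation (a : plane) : {perm plane} := perm (@addIr _ a).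

Lemma move_permE s a : move_perm s a = act s a.
Proof. by rewrite permE. Qed.

Lemma translationE a b : translation a b = b + a.
Proof. by rewrite permE. Qed.

Lemma move_permK s : (move_perm s * move_perm s = 1)%g.
Proof. by apply/permP => a; rewrite permM !move_permE actK perm1. Qed.

Lemma translationD a b : translation (a + b) = (translation a * translation b)%g.
Proof. by apply/permP => c; rewrite permM !translationE addrA. Qed.

Lemma translation0 : translation 0 = 1%g.
Proof. by apply/permP => c; rewrite translationE addr0 perm1. Qed.

Lemma translation_inj : injective translation.
Proof.
by move=> a b /permP/(_ 0); rewrite !translationE !add0r.
Qed.

Lemma translation_move a s :
  (translation a * move_perm s = move_perm s * translation (act s a))%g.
Proof. by apply/permP => b; rewrite !permM !translationE !move_permE actD. Qed.

(** The affine permutation is kept next to its linear part, because the edges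
    of the second factor are those crossed by the linear part only: a
    translation crosses none. *)
Definition level : finGroupType := ({perm plane} * parity_group {perm plane} move)%type.

Definition level_gen (i : generator) : level :=
  match i with
  | inl s => (move_perm s, walk move_perm s)
  | inr b => (translation (base b), 1%g)
  end.

Definition level_trans (a : plane) : level := (translation a, 1%g).

Lemma level_mulE (g h : level) : (g * h)%g = (g.1 * h.1, g.2 * h.2)%g.
Proof. by []. Qed.

Lemma level_transD a b : level_trans (a + b) = (level_trans a * level_trans b)%g.
Proof. by rewrite /level_trans level_mulE /= translationD mulg1. Qed.

Lemma level_trans_inj : injective level_trans.
Proof. by move=> a b [/translation_inj]. Qed.

Lemma level_trans_move a s :
  (level_trans a * level_gen (inl s) = level_gen (inl s) * level_trans (act s a))%g.
Proof. by rewrite /level_trans !level_mulE /= translation_move mul1g mulg1. Qed.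

Lemma level_mul_move g s : (g * level_gen (inl s))%g =
  ((g.1 * move_perm s)%g,
   (g.2.1 + crossing move_perm g.2.2 s, (g.2.2 * move_perm s)%g)).
Proof. by rewrite level_mulE mul_walk. Qed.

Lemma level_mul_base g b :
  (g * level_gen (inr b))%g = ((g.1 * translation (base b))%g, g.2).
Proof. by rewrite level_mulE mulg1. Qed.

Lemma level_genK i : (level_gen i * level_gen i = 1)%g.
Proof.
case: i => [s|b]; rewrite level_mulE /=.
  by rewrite move_permK walkK //; exact: move_permK.
by rewrite -translationD plane_addbb translation0 mulg1.
Qed.

End Plane.

(** * The tower of levels *)

Section Tower.
Variable n : nat.

Definition trunc_row (v : 'rV[bool]_n.+1) : 'rV[bool]_n :=
  \row_i v 0 (widen_ord (leqnSn n) i).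
Definition trunc (a : plane n.+1) : plane n := (trunc_row a.1, trunc_row a.2).

Lemma trunc_rowD u v : trunc_row (u + v) = trunc_row u + trunc_row v.
Proof. by apply/rowP => i; rewrite !mxE. Qed.

Lemma truncD a b : trunc (a + b) = trunc a + trunc b.
Proof. by congr (_, _); exact: trunc_rowD. Qed.

Lemma trunc_row_shift v : trunc_row (v *m shift n.+1) = trunc_row v *m shift n.
Proof.
apply/rowP => j; rewrite !mxE big_ord_recr /= !mxE /= gtn_eqF ?mulr0 ?addr0 ?ltnS 1?ltnW //.
by apply: eq_bigr => i _; rewrite !mxE.
Qed.

Lemma trunc_act s a : trunc (act s a) = act s (trunc a).
Proof.
by case: s => [[]|]; case: a => a b; rewrite /act /trunc /= trunc_rowD ?trunc_row_shift.
Qed.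

Lemma trunc_base b : trunc (base _ b) = base _ b.
Proof. by case: b; congr (_, _); apply/rowP => i; rewrite !mxE. Qed.

Lemma trunc_surj a : exists b, trunc b = a.
Proof.
have surj (v : 'rV[bool]_n) : exists u, trunc_row u = v.
  exists (\row_i oapp (v 0) 0 (unlift ord_max i)); apply/rowP => i; rewrite !mxE.
  suff -> : widen_ord (leqnSn n) i = lift ord_max i by rewrite liftK.
  by apply: val_inj; rewrite /= /bump leqNgt ltn_ord.
case: a => u v; have [u' <-] := surj u; have [v' <-] := surj v.
by exists (u', v').
Qed.

Implicit Types (q : {perm plane n.+1}) (r : {perm plane n}).

Definition intertwine (q : {perm plane n.+1}) (r : {perm plane n}) : bool :=
  [forall a, trunc (q a) == r (trunc a)].

Lemma intertwineP q r :
  reflect (forall a, trunc (q a) = r (trunc a)) (intertwine q r).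
Proof. exact: 'forall_eqP. Qed.

Lemma intertwine1 : intertwine 1 1.
Proof. by apply/intertwineP => a; rewrite !perm1. Qed.

Lemma intertwineM q r q' r' :
  intertwine q r -> intertwine q' r' -> intertwine (q * q') (r * r').
Proof.
by move=> /intertwineP h /intertwineP h'; apply/intertwineP => a; rewrite !permM h' h.
Qed.

Lemma intertwine_move s : intertwine (move_perm n.+1 s) (move_perm n s).
Proof. by apply/intertwineP => a; rewrite !move_permE trunc_act. Qed.

Lemma intertwine_base b : intertwine (translation (base n.+1 b)) (translation (base n b)).
Proof. by apply/intertwineP => a; rewrite !translationE truncD trunc_base. Qed.

(** A permutation that descends along [trunc] to no permutation has a default
    reduction; no walk from the identity meets such a permutation. *)
Definition reduce q : {perm plane n} := odflt 1%g [pick r | intertwine q r].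

Lemma reduceE q r : intertwine q r -> reduce q = r.
Proof.
rewrite /reduce; case: pickP => [r'|/(_ r)->//] /intertwineP h' /intertwineP h.
by apply/permP => a; have [b <-] := trunc_surj a; rewrite /= -h -h'.
Qed.

Definition push (f : {ffun {perm plane n.+1} * move -> bool}) :
    {ffun {perm plane n} * move -> bool} :=
  [ffun e => \sum_(q | reduce q == e.1) f (q, e.2)].

Lemma push0 : push 0 = 0.
Proof. by apply/ffunP => e; rewrite !ffunE big1 // => q _; rewrite ffunE. Qed.

Lemma push_crossing f q r s : intertwine q r ->
  push (f + crossing (move_perm n.+1) q s) = push f + crossing (move_perm n) r s.
Proof.
move=> qr; apply/ffunP => -[z t]; rewrite !ffunE /=.
under eq_bigr do rewrite !ffunE.
have pick_one (q' : {perm plane n.+1}) r' : reduce q' = r' ->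
    \sum_(i | reduce i == z) ((i, t) == (q', s) : bool) = ((z, t) == (r', s)).
  move=> q'r'; case: (eqVneq z r') => [zr'|zr'].
    rewrite (bigD1 q') ?q'r' ?zr' //= big1 ?addr0 ?xpair_eqE ?eqxx //.
    by move=> i /andP[_ /negPf iq']; rewrite xpair_eqE iq'.
  rewrite big1 => [|i /eqP iz]; first by rewrite xpair_eqE (negPf zr').
  rewrite xpair_eqE; case: eqP => // iq'; move: zr'.
  by rewrite -iz iq' q'r' eqxx.
rewrite !big_split /= (pick_one q r).
  rewrite (pick_one (q * move_perm _ s)%g (r * move_perm _ s)%g) //.
  by apply: reduceE; apply: intertwineM => //; exact: intertwine_move.
exact: reduceE.
Qed.

(** The relation between the values of one word at two successive levels. *)
Definition compatible (g : level n.+1) (h : level n) : Prop :=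
  [/\ intertwine g.1 h.1, intertwine g.2.2 h.2.2 & h.2.1 = push g.2.1].

Lemma compatible1 : compatible 1 1.
Proof. by split; rewrite ?intertwine1 // push0. Qed.

Lemma compatible_gen g h i :
  compatible g h -> compatible (g * level_gen _ i) (h * level_gen _ i).
Proof.
case=> g1 g2 g3; case: i => [s|b]; rewrite ?level_mul_move ?level_mul_base.
  split => /=.
  - by apply: intertwineM => //; exact: intertwine_move.
  - by apply: intertwineM => //; exact: intertwine_move.
  - by rewrite g3 (push_crossing _ _ g2).
by split => //=; apply: intertwineM => //; exact: intertwine_base.
Qed.

Lemma compatible_eq1 h : compatible 1 h -> h = 1%g.
Proof.
have inter1 (q : {perm plane n}) : intertwine 1 q -> q = 1%g.
  by move=> /reduceE <-; rewrite (reduceE intertwine1).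
by case: h => q [f r] [/= /inter1-> /inter1-> ->]; rewrite push0.
Qed.

(** Crossing parities at level [n] are sums of crossing parities at level
    [n.+1], hence the kernels of the successive levels are nested. *)
Lemma level_nested (w : seq generator) :
  (\prod_(i <- w) level_gen n.+1 i = 1)%g -> (\prod_(i <- w) level_gen n i = 1)%g.
Proof.
move=> w1; apply: compatible_eq1; rewrite -w1 => {w1}.
elim/last_ind: w => [|w i IHw]; first by rewrite !big_nil; exact: compatible1.
by rewrite -cats1 !big_cat !big_seq1; exact: compatible_gen.
Qed.

End Tower.

Section Words.
Variable n : nat.
Local Notation ev w := (\prod_(i <- w) level_gen n i)%g.

Lemma word_ind (Q : level n -> Prop) : Q 1%g ->
  (forall g i, Q g -> Q (g * level_gen n i)%g) -> forall w, Q (ev w).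
Proof.
move=> Q1 Qg; elim/last_ind => [|w i Qw]; first by rewrite big_nil.
by rewrite -cats1 big_cat big_seq1; exact: Qg.
Qed.

Lemma word_linear w (g := ev w) a : g.1 a = g.2.2 a + g.1 0.
Proof.
rewrite /g; move: a; pattern (ev w); apply: word_ind => [a|h i IHh a].
  by rewrite !perm1 addr0.
case: i => [s|b]; rewrite ?level_mul_move ?level_mul_base /= ?permM.
  by rewrite IHh !move_permE actD.
by rewrite !translationE IHh addrA.
Qed.

Lemma word_edge_parity w : edge_parity (move_perm n) (ev w).2.1.
Proof.
pattern (ev w); apply: word_ind => [|g [s|b] IHg].
- by split => q s; rewrite !ffunE.
- rewrite level_mul_move; apply: edge_parityD => //.
  by apply: edge_parity_crossing; exact: move_permK.
- by rewrite level_mul_base.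
Qed.

(** The boundary of the chain of a walk consists of its two ends. *)
Lemma word_boundary w (g := ev w) z :
  boundary g.2.1 z = (z == 1%g) + (z == g.2.2).
Proof.
rewrite /g; pattern (ev w); apply: word_ind => [|h [s|b] IHh].
- by rewrite /boundary big1 ?addbool_self // => s _; rewrite ffunE.
- rewrite level_mul_move boundaryD IHh boundary_crossing /=.
  by case: (_ == _); case: (_ == _); case: (_ == _).
- by rewrite level_mul_base.
Qed.

(** The wall metric of a level dominates the word metric of the group of
    linear parts: the edges crossed an odd number of times on the way from
    [g] to [h] contain a path between the linear parts. *)
Lemma wall_path v w (g := ev v) (h := ev w) :
  exists2 u : seq move, (size u <= #|[set e | g.2.1 e != h.2.1 e]|)%N
    & h.2.2 = (g.2.2 * \prod_(s <- u) move_perm n s)%g.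
Proof.
have [|z|u uE ->] := @boundary_path _ _ _ (@move_permK n)
  (g.2.1 + h.2.1) g.2.2 h.2.2.
- by apply: edge_parityD; exact: word_edge_parity.
- rewrite boundaryD !word_boundary.
  by case: (_ == _); case: (_ == _); case: (_ == _).
exists u => //; apply: leq_trans uE _; apply: subset_leq_card.
by apply/fintype.subsetP => e; rewrite !inE ffunE; case: (g.2.1 e); case: (h.2.1 e).
Qed.

Lemma wall_gen (g : level n) i :
  (#|[set e | g.2.1 e != (g * level_gen n i)%g.2.1 e]| <= 2)%N.
Proof.
case: i => [s|b]; last first.
  rewrite level_mul_base (_ : [set e | _] = set0) ?cards0 //.
  by apply/setP => e; rewrite !inE eqxx.
rewrite level_mul_move /=.
apply: (@leq_trans #|[set (g.2.2, s); ((g.2.2 * move_perm n s)%g, s)]|); last first.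
  by rewrite cards2; case: (_ != _).
apply/subset_leq_card/fintype.subsetP => e; rewrite !inE !ffunE.
by case: (g.2.1 e); case: (e == _); case: (e == _).
Qed.

End Words.

(** * Translations and the kernel of the linear part *)

Section Kernel.
Variable n : nat.
Local Notation ev w := (\prod_(i <- w) level_gen n i)%g.

Lemma card_plane : #|{: plane n}| = (2 ^ n * 2 ^ n)%N.
Proof. by rewrite card_prod !card_mx card_bool mul1n. Qed.

Let in_words (g : level n) := exists w, g = ev w.

Let in_wordsM g h : in_words g -> in_words h -> in_words (g * h)%g.
Proof. by move=> [v ->] [w ->]; exists (v ++ w); rewrite big_cat. Qed.

Let in_words_gen i : in_words (level_gen n i).
Proof. by exists [:: i]; rewrite big_seq1. Qed.

Let words_act a s : in_words (level_trans a) -> in_words (level_trans (act s a)).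
Proof.
move=> ha; have -> : level_trans (act s a) =
    (level_gen n (inl s) * (level_trans a * level_gen n (inl s)))%g.
  by rewrite level_trans_move mulgA level_genK mul1g.
by do !apply: in_wordsM.
Qed.

Let wordsD a b :
  in_words (level_trans a) -> in_words (level_trans b) -> in_words (level_trans (a + b)).
Proof. by rewrite level_transD; exact: in_wordsM. Qed.

(** The moves carry the two base vectors to all basis vectors, by
    multiplication by the variable. *)
Lemma trans_word a : exists w, level_trans a = ev w.
Proof.
have words0 : in_words (level_trans 0).
  by exists [::]; rewrite big_nil /level_trans translation0.
pose d k : 'rV[bool]_n := \row_i (i == k :> nat).
have d_shift k : d k *m shift n = d k.+1.
  apply/rowP => j; rewrite !mxE.
  have [kn|kn] := ltnP k n; last first.
    rewrite big1 => [|i _]; first by rewrite ltn_eqF // (leq_trans (ltn_ord j)) // leqW.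
    by rewrite !mxE ltn_eqF ?mul0r // (leq_trans _ kn).
  rewrite (bigD1 (Ordinal kn))//= big1 ?addr0 => [|i ik].
    by rewrite !mxE eqxx mul1r eq_sym.
  by rewrite !mxE -[_ == k :> nat]/(i == Ordinal kn) (negPf ik) mul0r.
have words_d k : in_words (level_trans (d k, 0)) /\ in_words (level_trans (0, d k)).
  elim: k => [|k [IH1 IH2]].
    by split; [exact: (in_words_gen (inr true))|exact: (in_words_gen (inr false))].
  have h1 := wordsD (words_act (Some true) IH1) IH1.
  have h2 := wordsD (words_act (Some false) IH2) IH2.
  move: h1 h2; rewrite /act /= !add0r d_shift.
  rewrite [X in level_trans X](_ : _ = (0, d k.+1)); last first.
    by congr (_, _); rewrite ?mx_addbb //= addr0.
  rewrite [X in _ -> in_words (level_trans X) -> _](_ : _ = (d k.+1, 0)) //.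
  by congr (_, _); rewrite ?mx_addbb //= addr0.
have row_d (v : 'rV[bool]_n) : v = \sum_(i | v 0 i) d i.
  rewrite [RHS]big_mkcond [LHS]row_sum_delta /=; apply: eq_bigr => i _.
  case: (v 0 i); last by rewrite scale0r.
  by rewrite scale1r; apply/rowP => j; rewrite !mxE eqxx -val_eqE /=; case: (_ == _).
rewrite -/(in_words _); case: a => u v.
have -> : (u, v) = (u, 0) + (0, v) :> plane n by congr (_, _); rewrite ?addr0 ?add0r.
apply: wordsD.
  rewrite (row_d u); elim/big_ind: _ => [//|x y hx hy|i _]; last exact: (words_d i).1.
  have -> : (x + y, 0) = (x, 0) + (y, 0) :> plane n by congr (_, _); rewrite /= addr0.
  exact: wordsD.
rewrite (row_d v); elim/big_ind: _ => [//|x y hx hy|i _]; last exact: (words_d i).2.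
have -> : (0, x + y) = (0, x) + (0, y) :> plane n by congr (_, _); rewrite /= addr0.
exact: wordsD.
Qed.

(** An affine permutation with trivial linear part is a translation, so the
    kernel of the linear part is elementary abelian. *)
Lemma kernel_form w (g := ev w) :
  g.2.2 = 1%g -> g = (translation (g.1 0), (g.2.1, 1%g)).
Proof.
have : forall a, g.1 a = g.2.2 a + g.1 0 := @word_linear n w.
move: g => [q [f r]] /= lin r1; rewrite r1 in lin *; congr (_, _).
by apply/permP => a; rewrite translationE {1}lin perm1.
Qed.

Lemma kernel_comm v w (g := ev v) (h := ev w) :
  g.2.2 = 1%g -> h.2.2 = 1%g -> (g * h = h * g)%g.
Proof.
rewrite /g /h => /kernel_form -> /kernel_form ->; rewrite !level_mulE !parity_mulE /=.
rewrite -!translationD addrC; congr (_, (_, _)).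
by rewrite addrC; congr (_ + _); apply/ffunP => -[q s]; rewrite !ffunE /= invg1 mul1g.
Qed.

Lemma kernel_invol w (g := ev w) : g.2.2 = 1%g -> (g * g = 1)%g.
Proof.
rewrite /g => /kernel_form ->; rewrite !level_mulE !parity_mulE /=.
rewrite -!translationD plane_addbb translation0 mulg1; congr (_, (_, _)).
by apply/ffunP => -[q s]; rewrite !ffunE /= invg1 mul1g addbool_self.
Qed.

End Kernel.

(** * The relative spectral gap *)

Section Valuation.
Variable n : nat.
Implicit Types (u v : 'cV[bool]_n) (x : dual n).

(** Indexed by all numbers, with value [false] beyond the dimension, so that
    the shift needs no boundary case. *)
Definition bit u k : bool := if insub k is Some i then u i 0 else false.

(** Equal to [n] exactly on 0. *)
Definition valuation u : nat := find (bit u) (iota 0 n).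

Lemma bitE u (i : 'I_n) : bit u i = u i 0.
Proof. by rewrite /bit valK. Qed.

Lemma bit_geq u k : (n <= k)%N -> bit u k = false.
Proof. by move=> nk; rewrite /bit insubF // ltnNge nk. Qed.

Lemma bitD u v k : bit (u + v) k = bit u k + bit v k.
Proof. by rewrite /bit; case: insub => // i; rewrite mxE. Qed.

Lemma bit_shift v k : bit (shift n *m v) k = bit v k.+1.
Proof.
have [kn|kn] := ltnP k n; last by rewrite !bit_geq // leqW.
rewrite (bitE _ (Ordinal kn)) mxE.
have [kn'|kn'] := ltnP k.+1 n; last first.
  rewrite bit_geq // big1 // => i _; rewrite mxE gtn_eqF ?mul0r //=.
  exact: leq_trans (ltn_ord i) kn'.
rewrite (bitE _ (Ordinal kn')) (bigD1 (Ordinal kn'))//= big1 ?addr0.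
  by rewrite mxE eqxx mul1r.
by move=> i /negPf ik; rewrite mxE /= -[_.+1 == _](eq_sym (i : nat)) [_ == _]ik mul0r.
Qed.

Lemma bit_lt_valuation u k : (k < valuation u)%N -> bit u k = false.
Proof.
move=> ku; have kn : (k < n)%N.
  by apply: leq_trans ku _; rewrite -[leqRHS](size_iota 0) find_size.
by have := before_find 0%N ku; rewrite nth_iota.
Qed.

Lemma valuation_leq u k : bit u k -> (valuation u <= k)%N.
Proof. by move=> uk; rewrite leqNgt; apply: contraL uk => /bit_lt_valuation->. Qed.

Lemma valuation_bit u : (valuation u < n)%N -> bit u (valuation u).
Proof.
move=> un; have := nth_find 0%N (_ : has (bit u) (iota 0 n)).
by rewrite nth_iota // add0n; apply; rewrite has_find size_iota.
Qed.

Lemma valuation_geq0 u : (n <= valuation u)%N -> u = 0.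
Proof.
move=> nu; apply/colP => i; rewrite mxE -bitE; apply: bit_lt_valuation.
exact: leq_trans nu.
Qed.

Lemma valuation_leqn u : (valuation u <= n)%N.
Proof. by rewrite -[leqRHS](size_iota 0) find_size. Qed.

(** Multiplying by the variable enlarges the ultrametric norm, so that it
    decides the sum. *)
Lemma valuation_addshift u v : bit v 0 = false -> (u, v) != 0 :> dual n ->
  (valuation v <= valuation u)%N -> (valuation (u + shift n *m v) < valuation v)%N.
Proof.
move=> v0 uv0 vu; have vn : (valuation v < n)%N.
  rewrite ltnNge; apply: contra uv0 => nv.
  by rewrite (valuation_geq0 nv) (valuation_geq0 (leq_trans nv vu)).
have := valuation_bit vn; case: (valuation v) vu => [|k] ku; first by rewrite v0.
move=> vk; rewrite ltnS; apply: valuation_leq.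
by rewrite bitD bit_shift vk bit_lt_valuation.
Qed.

Lemma valuation_add u v :
  (valuation v < valuation u)%N -> valuation (u + v) = valuation v.
Proof.
move=> vu; have vn := leq_trans vu (valuation_leqn u).
apply/eqP; rewrite eqn_leq valuation_leq; last first.
  by rewrite bitD valuation_bit // bit_lt_valuation.
rewrite leqNgt; apply/negP => uv.
have := valuation_bit (ltn_trans uv vn).
by rewrite bitD !bit_lt_valuation // (ltn_trans uv).
Qed.

Lemma pairing_base b x : pairing (base n b) x = bit (if b then x.1 else x.2) 0.
Proof.
have corner_bit v : (corner n *m v) 0 0 = bit v 0.
  have [n0|n0] := ltnP 0 n; last first.
    by rewrite bit_geq // mxE big1 // => i; have := leq_trans (ltn_ord i) n0.
  rewrite (bitE _ (Ordinal n0)) mxE (bigD1 (Ordinal n0))//= big1 ?addr0.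
    by rewrite mxE eqxx mul1r.
  by move=> i /negPf i0; rewrite mxE -[_ == 0%N]/(i == Ordinal n0) i0 mul0r.
by case: b; rewrite /pairing /= mul0mx ?addr0 ?add0r corner_bit.
Qed.

End Valuation.

Section Fourier.
Variables (R : realFieldType) (n : nat).
Implicit Types (f : level n -> R) (x : level n) (c : dual n) (a b : plane n).
Local Notation t := (@level_trans n).

Definition character a c : R := (-1) ^+ pairing a c.

Lemma signrDb (p q : bool) : (-1) ^+ (p + q)%R = (-1) ^+ p * (-1) ^+ q :> R.
Proof. by case: p; case: q; rewrite ?mul1r ?mulr1 ?mulrNN ?mulr1. Qed.

Lemma characterDl a b c : character (a + b) c = character a c * character b c.
Proof. by rewrite /character pairingDl signrDb. Qed.

Lemma characterDr a c d : character a (c + d) = character a c * character a d.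
Proof. by rewrite /character pairingDr signrDb. Qed.

Lemma sum_character a : \sum_c character a c = if a == 0 then #|{: dual n}|%:R else 0.
Proof.
case: eqP => [->|/eqP/pairing_separates[d ad]].
  rewrite (eq_bigr (fun=> 1)) ?sumr_const // => c _.
  by rewrite /character /pairing /= !mul0mx addr0 mxE.
have : \sum_c character a c = - \sum_c character a c.
  rewrite [LHS](reindex_inj (addrI d)) -sumrN; apply: eq_bigr => c _.
  by rewrite characterDr /character ad mulN1r.
by move: (\sum_c _) => S h; lra.
Qed.

(** The component of [f] along [c] for right translations, up to the factor
    [#|plane n|]. *)
Definition coeff f c x : R := \sum_a character a c * f (x * t a)%g.
Definition energy f c : R := \sum_x coeff f c x ^+ 2.

Lemma energy_ge0 f c : 0 <= energy f c.
Proof. by apply: sumr_ge0 => x _; exact: sqr_ge0. Qed.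

Lemma parseval f :
  \sum_c energy f c = (#|{: dual n}| * #|{: plane n}|)%:R * \sum_x f x ^+ 2.
Proof.
have pointwise x : \sum_c coeff f c x ^+ 2 =
    #|{: dual n}|%:R * \sum_a f (x * t a)%g ^+ 2.
  transitivity (\sum_a \sum_b f (x * t a)%g * f (x * t b)%g * \sum_c character (a + b) c).
    under eq_bigr do rewrite expr2 /coeff big_distrlr.
    rewrite exchange_big; apply: eq_bigr => a _.
    rewrite exchange_big; apply: eq_bigr => b _.
    rewrite mulr_sumr; apply: eq_bigr => c _; rewrite characterDl /=; ring.
  rewrite [RHS]mulr_sumr; apply: eq_bigr => a _.
  rewrite (bigD1 a)//= [X in _ + X]big1 => [|b ba].
    by rewrite sum_character plane_addbb eqxx addr0; ring.
  rewrite sum_character ifF ?mulr0 //; apply: contraNF ba => /eqP ab.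
  by rewrite -[b]add0r -(plane_addbb a) -addrA ab addr0.
rewrite exchange_big; under eq_bigr do rewrite pointwise.
rewrite -mulr_sumr exchange_big natrM -mulrA; congr (_ * _).
under eq_bigr => a _.
  rewrite (_ : \sum_x _ = \sum_x f x ^+ 2); last first.
    by rewrite [RHS](reindex_inj (mulIg (t a))).
  over.
by rewrite sumr_const mulr_natl.
Qed.

Definition translate f (g : level n) x : R := f (x * g)%g.

(** Translating by a move permutes the isotypic components, since the move
    normalises the translations; a translation acts on each by a sign. *)
Lemma coeff_move f s c x :
  coeff (translate f (level_gen n (inl s))) c x =
  coeff f (coact s c) (x * level_gen n (inl s))%g.
Proof.
rewrite /coeff [RHS](reindex_inj (can_inj (@actK n s))); apply: eq_bigr => a _.
by rewrite /character pairing_act coactK /translate -!mulgA level_trans_move.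
Qed.

Lemma coeff_base f (b : bool) c x :
  coeff (translate f (level_gen n (inr b))) c x = character (base n b) c * coeff f c x.
Proof.
rewrite /coeff [RHS]mulr_sumr [RHS](reindex_inj (addIr (base n b))) /=.
apply: eq_bigr => a _; rewrite /translate -mulgA -level_transD mulrA; congr (_ * _).
by rewrite -characterDl addrCA plane_addbb addr0.
Qed.

Lemma coeffB f g c x : coeff (fun y => f y - g y) c x = coeff f c x - coeff g c x.
Proof. by rewrite /coeff -sumrB; apply: eq_bigr => a _; rewrite mulrBr. Qed.

Definition variation f i : R := \sum_x (f (x * level_gen n i)%g - f x) ^+ 2.

Local Notation scaled_variation f i :=
  ((#|{: dual n}| * #|{: plane n}|)%:R * variation f i).

Let parseval_variation f i :
  \sum_c energy (fun y => translate f (level_gen n i) y - f y) c = scaled_variation f i.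
Proof. by rewrite parseval. Qed.

(** On the components where a base translation acts by -1, it moves the
    function by twice its size. *)
Lemma energy_base f (b : bool) :
  4 * \sum_(c | bit (if b then c.1 else c.2) 0) energy f c <= scaled_variation f (inr b).
Proof.
rewrite -parseval_variation [leRHS](bigID (fun c => bit (if b then c.1 else c.2) 0)) /=.
rewrite -[leLHS]addr0 lerD ?sumr_ge0 // => [|c _]; last exact: energy_ge0.
rewrite mulr_sumr ler_sum // => c c0; rewrite /energy mulr_sumr ler_sum // => x _.
rewrite coeffB coeff_base /character pairing_base c0 expr1; lra.
Qed.

(** The constants come from the inequality
    p^2 <= (1 + h) q^2 + (1 + 1/h) (q - p)^2 at h = 1/10. *)
Lemma energy_move f s (B B' : pred (dual n)) :
  (forall c, B c -> B' (coact s c)) ->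
  \sum_(c | B c) energy f c <=
    11 / 10 * \sum_(c | B' c) energy f c + 11 * scaled_variation f (inl s).
Proof.
move=> BB'; set D := scaled_variation f _.
have -> : D = \sum_c energy (fun y => translate f (level_gen n (inl s)) y - f y) c.
  by rewrite parseval_variation.
apply: (@le_trans _ _ (\sum_(c | B c) (11 / 10 * energy f (coact s c) + 11 *
    energy (fun y => translate f (level_gen n (inl s)) y - f y) c))).
  apply: ler_sum => c _.
  rewrite [energy f (coact s c)](reindex_inj (mulIg (level_gen n (inl s)))).
  rewrite /energy 2!mulr_sumr -big_split ler_sum // => x _.
  rewrite coeffB coeff_move /=; set p := coeff f c x; set q := coeff f _ _.
  have := sqr_ge0 (q / 10 + (q - p)); lra.
rewrite big_split /= -!mulr_sumr lerD // ler_wpM2l ?divr_ge0 //.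
  rewrite (reindex_inj (can_inj (@coactK n s))).
  under eq_bigr do rewrite coactK.
  rewrite [leLHS]big_mkcond [leRHS]big_mkcond ler_sum //= => c _.
  case: ifPn => [/BB'|_]; first by rewrite coactK => ->.
  by case: ifP => // _; exact: energy_ge0.
rewrite [leRHS](bigID B) /= lerDl sumr_ge0 // => c _; exact: energy_ge0.
Qed.

(** The weights [energy f] on the dual are almost invariant under the moves,
    and almost carried by the pairs with two coordinates of positive valuation.
    On these pairs, one move sends the regions
    [valuation c.2 < valuation c.1] and [valuation c.1 = valuation c.2] into
    [valuation c.1 < valuation c.2], and its mirror image does the same with
    the coordinates exchanged. Adding the two comparisons shows that the
    diagonal is light. The third move sends [valuation c.2 < valuation c.1] to
    the diagonal, so this region is light too, and the last region is compared
    with it by the mirror image. The value 40 bounds the constant that results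
    from these comparisons. *)
Lemma relative_gap f :
  (forall x, \sum_a f (x * t a)%g = 0) ->
  \sum_x f x ^+ 2 <= 40 * \sum_i variation f i.
Proof.
move=> f0; set N : R := (#|{: dual n}| * #|{: plane n}|)%:R.
have N0 : 0 < N by rewrite ltr0n muln_gt0; apply/andP; split; apply/card_gt0P; exists 0.
rewrite -(ler_pM2l N0) -parseval mulrCA.
pose nu1 (c : dual n) := valuation c.1; pose nu2 (c : dual n) := valuation c.2.
pose X c := (nu2 c < nu1 c)%N; pose Y c := (nu1 c < nu2 c)%N.
pose Z c := (nu1 c == nu2 c) && (c != 0).
pose b1 (c : dual n) := bit c.1 0; pose b2 (c : dual n) := bit c.2 0.
pose w (B : pred (dual n)) := \sum_(c | B c) energy f c.
have w0 B : 0 <= w B by apply: sumr_ge0 => c _; exact: energy_ge0.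
have energy0 : energy f 0 = 0.
  rewrite /energy big1 // => x _; rewrite /coeff (eq_bigr (fun a => f (x * t a)%g)).
    by rewrite f0 expr0n.
  by move=> a _; rewrite /character /pairing /= !mulmx0 addr0 mxE mul1r.
have total : \sum_c energy f c = w X + w Y + w Z.
  rewrite /w (bigD1 0)//= energy0 add0r [X in _ = X + _ + _]big_mkcond.
  rewrite [X in _ = _ + X + _]big_mkcond [X in _ = _ + _ + X]big_mkcond.
  rewrite [LHS]big_mkcond -!big_split; apply: eq_bigr => c _ /=.
  rewrite /Z /X /Y; case: eqVneq => [->|c0] /=; first by rewrite ltnn andbF !addr0.
  by case: ltngtP => _; rewrite ?addr0 ?add0r.
have wU (B B1 B2 : pred (dual n)) : (forall c, B c -> B1 c || B2 c) -> w B <= w B1 + w B2.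
  move=> hB; rewrite /w [leLHS]big_mkcond [X in _ <= X + _]big_mkcond.
  rewrite [X in _ <= _ + X]big_mkcond -big_split ler_sum //= => c _.
  have := hB c; have := energy_ge0 f c.
  by case: (B c); case: (B1 c); case: (B2 c) => e0 hb; (lra || by have := hb isT).
have wXZ : w X + w Z = w (fun c => X c || Z c).
  rewrite [RHS](bigID X); congr (_ + _); apply: eq_bigl => c.
    by case: (X c); rewrite ?andbF.
  by rewrite /X /Z; case: ltngtP; rewrite ?andbF //= andbT.
have wYZ : w Y + w Z = w (fun c => Y c || Z c).
  rewrite [RHS](bigID Y); congr (_ + _); apply: eq_bigl => c.
    by case: (Y c); rewrite ?andbF.
  by rewrite /Y /Z; case: ltngtP; rewrite ?andbF //= andbT.
have e1 := energy_base f true; have e2 := energy_base f false.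
have hA : w X + w Z <= w b2 + (11 / 10 * w Y + 11 * (N * variation f (inl (Some true)))).
  rewrite wXZ; apply: le_trans (wU _ b2 (fun c => (X c || Z c) && ~~ b2 c) _) _.
    by move=> c; case: (b2 c); rewrite ?orbT // andbT.
  rewrite lerD2l; apply: energy_move => -[u v] /andP[XZ].
  rewrite /b2 /= => /negPf v0; apply: valuation_addshift => //.
    case/orP: XZ => [|/andP[] //]; rewrite /X /nu1 /nu2 /=.
    by apply: contraTneq => -[-> ->]; rewrite ltnn.
  by case/orP: XZ => [/ltnW|/andP[/eqP + _]] //; rewrite /nu1 /nu2 /= => ->.
have hB : w Y + w Z <= w b1 + (11 / 10 * w X + 11 * (N * variation f (inl (Some false)))).
  rewrite wYZ; apply: le_trans (wU _ b1 (fun c => (Y c || Z c) && ~~ b1 c) _) _.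
    by move=> c; case: (b1 c); rewrite ?orbT // andbT.
  rewrite lerD2l; apply: energy_move => -[u v] /andP[YZ].
  rewrite /b1 /= => /negPf u0; apply: valuation_addshift => //.
    case/orP: YZ => [|/andP[_]]; last by rewrite !xpair_eqE andbC.
    by rewrite /Y /nu1 /nu2 /=; apply: contraTneq => -[-> ->]; rewrite ltnn.
  by case/orP: YZ => [/ltnW|/andP[/eqP + _]] //; rewrite /nu1 /nu2 /= => ->.
have hC : w X <= 11 / 10 * w Z + 11 * (N * variation f (inl None)).
  apply: energy_move => -[u v]; rewrite /X /Z /nu1 /nu2 /= => vu.
  rewrite (valuation_add vu) eqxx /= xpair_eqE negb_and; apply/orP; right.
  apply: contraTneq (valuation_bit (leq_trans vu (valuation_leqn u))) => ->.
  by rewrite /bit; case: insub => // i; rewrite mxE.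
have d0 i : 0 <= N * variation f i.
  by rewrite mulr_ge0 ?(ltW N0) // sumr_ge0 // => x _; exact: sqr_ge0.
have -> : \sum_i variation f i = variation f (inl None) + variation f (inl (Some true))
    + variation f (inl (Some false)) + variation f (inr true) + variation f (inr false).
  rewrite big_sumType big_bool (bigD1 None)//= (bigD1 (Some true))//=.
  rewrite (bigD1 (Some false))//= big1 => [|[[]|]//]; ring.
rewrite total !mulrDr; have := w0 X; have := w0 Y; have := w0 Z.
have := d0 (inl None); have := d0 (inl (Some true)); have := d0 (inl (Some false)).
have := d0 (inr true); have := d0 (inr false).
move: e1 e2 hA hB hC; rewrite -/(w b1) -/(w b2) -/N.
lra.
Qed.

End Fourier.

From mathcomp Require Import all_classical all_reals all_analysis.
From mathcomp Require Import measurable_realfun ess_sup_inf.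
Import numFieldNormedType.Exports.

(** * Powers *)

Section Powers.
Variables (R : realType) (p : R).
Hypothesis p1 : 1 <= p.
Implicit Types a b u v : R.

Let p0 : 0 < p. Proof. exact: lt_le_trans p1. Qed.

Let powR_le a b : 0 <= a -> a <= b -> a `^ p <= b `^ p.
Proof. by move=> a0 ab; apply: ge0_ler_powR; rewrite ?nnegrE ?(ltW p0) // (le_trans a0). Qed.

Lemma powR2_ge1 : 1 <= 2 `^ p :> R.
Proof. by rewrite -[leLHS](powRr0 2) ler_powR ?ler1n // ltW. Qed.

Lemma powR_add_le a b : 0 <= a -> 0 <= b -> (a + b) `^ p <= 2 `^ p * (a `^ p + b `^ p).
Proof.
move=> a0 b0; wlog ab : a b a0 b0 / a <= b => [th|].
  have [/th|/ltW/th] := leP a b; first exact.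
  by rewrite addrC [_ `^ p + _]addrC; exact.
apply: (@le_trans _ _ ((2 * b) `^ p)); first by apply: powR_le; lra.
by rewrite powRM // ler_wpM2l ?powR_ge0 // lerDr powR_ge0.
Qed.

Lemma powR_superadd a b : 0 <= a -> 0 <= b -> a `^ p + b `^ p <= (a + b) `^ p.
Proof.
move=> a0 b0; rewrite -!(mulr_powRB1 _ p0) ?addr_ge0 // mulrDl.
by apply: lerD; apply: ler_wpM2l => //; apply: ge0_ler_powR;
  rewrite ?nnegrE ?subr_ge0 ?addr_ge0 // ?lerDl ?lerDr.
Qed.

Lemma powR_normB_le u v : `|u - v| `^ p <= 2 `^ p * (`|u| `^ p + `|v| `^ p).
Proof.
apply: le_trans (powR_add_le (normr_ge0 u) (normr_ge0 v)).
by apply: powR_le => //; exact: ler_normB.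
Qed.

Definition signed_power u : R := Num.sg u * `|u| `^ p.

Lemma signed_power_ge0 u : 0 <= u -> signed_power u = u `^ p.
Proof.
rewrite le_eqVlt => /orP[/eqP<-|u0]; last by rewrite /signed_power gtr0_sg // mul1r gtr0_norm.
by rewrite /signed_power sgr0 mul0r powR0 ?gt_eqF.
Qed.

Lemma signed_powerN u : signed_power (- u) = - signed_power u.
Proof. by rewrite /signed_power sgrN normrN mulNr. Qed.

Let sign_cases (Q : R -> R -> Prop) :
  (forall u v, Q u v -> Q v u) -> (forall u v, Q u v -> Q (- u) (- v)) ->
  (forall u v, 0 <= v <= u -> Q u v) -> (forall u v, 0 <= u -> 0 <= v -> Q u (- v)) ->
  forall u v, Q u v.
Proof.
move=> sym neg same opp u v.
wlog uv : u v / v <= u => [th|].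
  have [/th//|/ltW/th] := leP v u; exact: sym.
have [v0|/ltW v0] := leP 0 v; first by apply: same; rewrite v0.
have [u0|/ltW u0] := leP 0 u; first by rewrite -[v]opprK; apply: opp; rewrite ?oppr_ge0.
by rewrite -[u]opprK -[v]opprK; apply/neg/sym/same; rewrite oppr_ge0 u0 lerN2.
Qed.

(** Together with [signed_power_upper], this makes the signed power turn an
    estimate for absolute values into one for [p]-th powers. *)
Lemma signed_power_lower u v :
  `|u - v| `^ p <= 2 `^ p * `|signed_power u - signed_power v|.
Proof.
move: u v; apply: sign_cases => [u v|u v|u v /andP[v0 vu]|u v u0 v0].
- by rewrite distrC [in leRHS]distrC.
- by rewrite !signed_powerN -!opprD !normrN.
- have u0 := le_trans v0 vu; rewrite !signed_power_ge0 // ger0_norm ?subr_ge0 //.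
  rewrite ger0_norm ?subr_ge0; last exact: powR_le.
  have := powR_superadd v0 (_ : 0 <= u - v); rewrite subr_ge0 => /(_ vu).
  rewrite [v + _]addrC subrK => h; have := powR2_ge1; have := powR_ge0 (u - v) p; nra.
- rewrite signed_powerN !opprK !signed_power_ge0 // !ger0_norm ?addr_ge0 ?powR_ge0 //.
  exact: powR_add_le.
Qed.

Lemma bernoulli (s : R) k : 0 <= s <= 1 -> 1 - k%:R * s <= (1 - s) ^+ k.
Proof.
move=> /andP[s0 s1]; elim: k => [|k IHk]; first by rewrite mul0r subr0 expr0.
rewrite exprS -natr1; have k0 : 0 <= k%:R :> R by [].
have := ler_wpM2l (_ : 0 <= 1 - s) IHk; rewrite subr_ge0 => /(_ s1).
by apply: le_trans; nra.
Qed.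

(** If [u] and [v] are relatively close, then the ratio of their powers is close
    to 1; otherwise both powers are bounded by a multiple of the power of the
    difference. *)
Lemma signed_power_upper (e : R) : 0 < e < 1 -> exists2 C : R, 0 <= C & forall u v,
  `|signed_power u - signed_power v| <= e * (`|u| `^ p + `|v| `^ p) + C * `|u - v| `^ p.
Proof.
move=> /andP[e0 e1]; pose k := (Num.truncn p).+1.
have pk : p <= k%:R by apply: ltW; rewrite /k truncnS_gt.
have k0 : 0 < k%:R :> R by rewrite ltr0n.
(* Bernoulli's inequality makes relative distance [s] small enough. *)
pose s := e / k%:R; have s0 : 0 < s by rewrite divr_gt0.
have sk : k%:R * s = e by rewrite /s mulrC divfK ?gt_eqF.
have s1 : s < 1 by rewrite ltr_pdivrMr // mul1r (lt_le_trans e1) // (le_trans p1).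
have small : 1 - e <= (1 - s) `^ p.
  apply: (@le_trans _ _ ((1 - s) `^ k%:R)).
    by rewrite powR_mulrn ?subr_ge0 ?(ltW s1) // -sk bernoulli // ltW //= ltW.
  by apply: ger_powR => //; lra.
have C0 : 0 <= s^-1 `^ p := powR_ge0 _ _.
exists (2 + s^-1 `^ p); first lra.
apply: sign_cases => [u v|u v|u v /andP[v0 vu]|u v u0 v0].
- by rewrite distrC [`|u - v|]distrC [_ + `|v| `^ p]addrC.
- by rewrite !signed_powerN -!opprD !normrN.
- have u0 := le_trans v0 vu; rewrite !signed_power_ge0 // [`|u - v|]ger0_norm ?subr_ge0 //.
  rewrite ger0_norm ?subr_ge0; last exact: powR_le.
  rewrite !ger0_norm //.
  have hu := powR_ge0 u p; have hv := powR_ge0 v p; have huv := powR_ge0 (u - v) p.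
  have [uv|/ltW uv] := leP (u - v) (s * u).
    have : (1 - s) `^ p * u `^ p <= v `^ p.
      by rewrite -powRM ?subr_ge0 ?(ltW s1) //; apply: powR_le; nra.
    have := ler_wpM2r hu small; nra.
  have : u `^ p <= s^-1 `^ p * (u - v) `^ p.
    rewrite -powRM ?invr_ge0 ?(ltW s0) ?subr_ge0 //; apply: powR_le => //.
    by rewrite -(ler_pM2l s0) mulVKf ?gt_eqF.
  nra.
- rewrite signed_powerN !opprK normrN !signed_power_ge0 // !ger0_norm ?addr_ge0 ?powR_ge0 //.
  have := powR_superadd u0 v0; have := powR_ge0 u p; have := powR_ge0 v p; nra.
Qed.

(** Not the sharp convexity inequality: the values below half the mean
    contribute at most half of it. *)
Lemma powR_mean (I : finType) (z : I -> R) :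
  (forall i, 0 <= z i) -> (0 < #|I|)%N ->
  ((\sum_i z i) / #|I|%:R) `^ p <= 2 `^ p * ((\sum_i z i `^ p) / #|I|%:R).
Proof.
move=> z0 I0; have N0 : 0 < #|I|%:R :> R by rewrite ltr0n.
set m := (\sum_i z i) / _; have m0 : 0 <= m by rewrite divr_ge0 ?sumr_ge0 // ltW.
have -> : m = 2 * (m / 2) by field.
have h2 : 0 <= m / 2 by lra.
rewrite powRM // ler_wpM2l ?powR_ge0 // ler_pdivlMr //.
have mE : \sum_i z i = m * #|I|%:R by rewrite /m divfK ?gt_eqF.
have low i : (z i - m / 2) * (m / 2) `^ (p - 1) <= z i `^ p.
  have [zm|zm] := leP (m / 2) (z i).
    rewrite -(mulr_powRB1 _ p0) // ler_pM ?subr_ge0 ?powR_ge0 //; first lra.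
    by apply: ge0_ler_powR; rewrite ?nnegrE ?subr_ge0.
  by apply: le_trans (powR_ge0 _ _); rewrite mulr_le0_ge0 ?powR_ge0 //; lra.
apply: le_trans (ler_sum _ (fun i _ => low i)).
rewrite -mulr_suml sumrB mE sumr_const -[(m / 2) `^ p](mulr_powRB1 _ p0) //.
rewrite -(mulr_natr (m / 2)) mulrAC ler_wpM2r ?powR_ge0 //; lra.
Qed.

End Powers.

(** * The relative gap for powers *)

Section CutCone.
Variables (R : realDomainType) (T J K : finType) (p q : J -> T) (r s : K -> T) (C : R).

(** A real function is a nonnegative combination of indicators of its
    superlevel sets, plus a constant, and the distances between its values are
    the same combination of distances between values of the indicators. *)
Lemma cut_cone :
  (forall B : {set T}, \sum_j `|(p j \in B)%:R - (q j \in B)%:R| <=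
    C * \sum_k `|(r k \in B)%:R - (s k \in B)%:R| :> R) ->
  forall f : T -> R, \sum_j `|f (p j) - f (q j)| <= C * \sum_k `|f (r k) - f (s k)|.
Proof.
move=> cut f; pose high (g : T -> R) := [set x | [exists y, g y < g x]].
have [m] := ubnP #|high f|; elim: m f => // m IHm f; rewrite ltnS => fm.
have [h0|[z zh]] := set_0Vmem (high f).
  have fc x y : f x = f y.
    apply/le_anti/andP; split; rewrite leNgt; apply/negP => xy.
      by have : x \in high f; [rewrite inE; apply/existsP; exists y|rewrite h0 inE].
    by have : y \in high f; [rewrite inE; apply/existsP; exists x|rewrite h0 inE].
  rewrite !big1 ?mulr0 // => i _; first by rewrite (fc _ (s i)) subrr normr0.
  by rewrite (fc _ (q i)) subrr normr0.
set B := high f in zh.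
have [b bB bmin] : {b | b \in B & forall x, x \in B -> f b <= f x}.
  by case: (arg_minP f zh) => b; exists b.
have [c cmin] : {c | forall x, f c <= f x}.
  by case: (@arg_minP _ _ _ z xpredT f isT) => c _ cmin; exists c => x; exact: cmin.
have notB x : x \notin B -> f x = f c.
  rewrite inE negb_exists => /forallP/(_ c); rewrite -leNgt => xc.
  by apply/le_anti; rewrite xc cmin.
have cb : f c <= f b := cmin b.
pose g x := Num.max (f x) (f b).
have gB x : x \in B -> g x = f x by move=> xB; rewrite /g max_l // bmin.
have gNB x : x \notin B -> g x = f b by move=> xB; rewrite /g max_r // (notB x xB).
have split_dist x y : `|f x - f y| =
    `|g x - g y| + (f b - f c) * `|(x \in B)%:R - (y \in B)%:R|.
  have [xB|xB] := boolP (x \in B); have [yB|yB] := boolP (y \in B).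
  - by rewrite !gB // subrr normr0 mulr0 addr0.
  - rewrite gB // gNB // (notB y) // subr0 normr1 mulr1.
    by rewrite !ger0_norm ?subr_ge0 ?bmin //; lra.
  - rewrite (gB y) // gNB // (notB x) // sub0r normrN normr1 mulr1.
    by rewrite !ler0_norm ?subr_le0 ?bmin //; lra.
  - by rewrite !gNB // (notB x) // (notB y) // !subrr normr0 mulr0 addr0.
have gm : (#|high g| < m)%N.
  apply: leq_trans fm; apply: proper_card; apply/properP; split.
    apply/fintype.subsetP => x; rewrite inE => /existsP[y yx].
    by apply: contraLR yx => xB; rewrite (gNB x xB) -leNgt le_max lexx orbT.
  exists b => //; rewrite inE negb_exists; apply/forallP => y.
  by rewrite (gB b bB) -leNgt le_max lexx orbT.
under eq_bigr do rewrite split_dist.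
under [X in _ <= C * X]eq_bigr do rewrite split_dist.
rewrite !big_split -!mulr_sumr mulrDr lerD ?IHm // mulrCA ler_wpM2l ?subr_ge0 //.
Qed.

End CutCone.

Section Mean.
Variables (R : realType) (n : nat) (V : lmodType R).
Implicit Types (f : level n -> V) (x : level n) (a : plane n).
Local Notation t := (@level_trans n).

Lemma card_plane_gt0 : (0 < #|{: plane n}|)%N.
Proof. by apply/card_gt0P; exists 0. Qed.

Definition mean f x : V := #|{: plane n}|%:R^-1 *: \sum_a f (x * t a)%g.

Let N0 : #|{: plane n}|%:R != 0 :> R.
Proof. by rewrite pnatr_eq0 -lt0n card_plane_gt0. Qed.

Lemma mean_trans f a x : mean f (x * t a)%g = mean f x.
Proof.
congr (_ *: _); rewrite [RHS](reindex_inj (addrI a)); apply: eq_bigr => b _.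
by rewrite level_transD mulgA.
Qed.

Lemma meanB f g x : mean (fun y => f y - g y) x = mean f x - mean g x.
Proof. by rewrite /mean sumrB scalerBr. Qed.

(** The generators normalise the translations, so averaging over the cosets
    of the translations commutes with them. *)
Lemma mean_gen f i x :
  mean (fun y => f (y * level_gen n i)%g) x = mean f (x * level_gen n i)%g.
Proof.
congr (_ *: _); case: i => [s|b].
  rewrite [RHS](reindex_inj (can_inj (@actK n s))); apply: eq_bigr => a _.
  by rewrite -mulgA level_trans_move mulgA.
apply: eq_bigr => a _; rewrite -!mulgA -[level_gen n _]/(t (base n b)).
by rewrite -!level_transD addrC.
Qed.

Lemma mean_cst (c : V) x : mean (fun=> c) x = c.
Proof. by rewrite /mean sumr_const -(scaler_nat _ c) scalerA mulVf // scale1r. Qed.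

Lemma mean_idem f x : mean (mean f) x = mean f x.
Proof.
rewrite {1}/mean (eq_bigr (fun=> mean f x)) => [|a _]; last exact: mean_trans.
exact: mean_cst.
Qed.

Definition centered f x := f x - mean f x.

Lemma centered_sum f x : \sum_a centered f (x * t a)%g = 0.
Proof.
have := meanB f (mean f) x; rewrite mean_idem subrr => /eqP.
by rewrite scaler_eq0 invr_eq0 (negPf N0) => /eqP.
Qed.

End Mean.

Section Gaps.
Variables (R : realType) (n : nat).
Implicit Types (f : level n -> R) (x : level n) (a : plane n).
Local Notation t := (@level_trans n).
Local Notation N := (#|{: plane n}|%:R : R).
Local Notation meanR f := (@mean R n R^o f).
Local Notation centeredR f := (@centered R n R^o f).

Let N0 : 0 < N. Proof. by rewrite ltr0n card_plane_gt0. Qed.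

Let meanE f x : meanR f x = (\sum_a f (x * t a)%g) / N.
Proof. by rewrite /mean [LHS]mulrC. Qed.

Let sum_trans (F : level n -> R) : \sum_x \sum_a F (x * t a)%g = N * \sum_x F x.
Proof.
rewrite exchange_big (eq_bigr (fun=> \sum_x F x)) ?sumr_const ?mulr_natl // => a _.
by rewrite [RHS](reindex_inj (mulIg (t a))).
Qed.

Section Exponent.
Variable p : R.
Hypothesis p1 : 1 <= p.

Lemma sum_mean_le f : \sum_x `|meanR f x| `^ p <= 2 `^ p * \sum_x `|f x| `^ p.
Proof.
apply: (@le_trans _ _ (\sum_x 2 `^ p * ((\sum_a `|f (x * t a)%g| `^ p) / N))).
  apply: ler_sum => x _; apply: le_trans (powR_mean p1 _ (card_plane_gt0 n)) => //.
  have p0 : 0 <= p by exact: le_trans p1.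
  apply: ge0_ler_powR => //; rewrite ?nnegrE ?divr_ge0 ?sumr_ge0 //.
  rewrite meanE normrM normfV [`|N|]ger0_norm // ler_wpM2r ?invr_ge0 //.
  exact: ler_norm_sum.
rewrite -mulr_sumr -mulr_suml (sum_trans (fun x => `|f x| `^ p)) mulrAC.
by rewrite divff ?gt_eqF // mul1r.
Qed.

Lemma variation_centered f i :
  \sum_x `|centeredR f (x * level_gen n i)%g - centeredR f x| `^ p <=
  2 `^ p * (1 + 2 `^ p) * \sum_x `|f (x * level_gen n i)%g - f x| `^ p.
Proof.
pose d x := f (x * level_gen n i)%g - f x.
have cE x : centeredR f (x * level_gen n i)%g - centeredR f x = d x - meanR d x.
  have -> : meanR d x = meanR f (x * level_gen n i)%g - meanR f x.
    by rewrite -(@mean_gen R n R^o) -(@meanB R n R^o).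
  by rewrite /centered /d; ring.
under eq_bigr do rewrite cE.
apply: (@le_trans _ _ (\sum_x 2 `^ p * (`|d x| `^ p + `|meanR d x| `^ p))).
  by apply: ler_sum => x _; exact: powR_normB_le.
rewrite -mulr_sumr -mulrA ler_wpM2l ?powR_ge0 // big_split mulrDl mul1r lerD2l.
exact: sum_mean_le.
Qed.

End Exponent.

Lemma sum_centered_dist p f : 1 <= p ->
  \sum_x \sum_a `|f (x * t a)%g - f x| `^ p <=
  2 `^ p * 2 * N * \sum_x `|centeredR f x| `^ p.
Proof.
move=> p1; pose u := centeredR f.
apply: (@le_trans _ _ (\sum_x \sum_a 2 `^ p * (`|u (x * t a)%g| `^ p + `|u x| `^ p))).
  apply: ler_sum => x _; apply: ler_sum => a _.
  have -> : f (x * t a)%g - f x = u (x * t a)%g - u x.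
    by rewrite /u /centered (@mean_trans R n R^o); ring.
  exact: powR_normB_le.
under eq_bigr do rewrite -mulr_sumr big_split sumr_const -[_ *+ #|_|]mulr_natl /=.
rewrite -mulr_sumr big_split -mulr_sumr /= (sum_trans (fun x => `|u x| `^ p)).
by rewrite le_eqVlt; apply/orP; left; apply/eqP; ring.
Qed.

(** For an indicator function, distances and squared distances agree. *)
Lemma gap_L1 f : \sum_x \sum_a `|f (x * t a)%g - f x| <=
  6400 * N * \sum_i \sum_x `|f (x * level_gen n i)%g - f x|.
Proof.
pose J : finType := (level n * plane n)%type; pose K : finType := (generator * level n)%type.
rewrite !pair_big /=.
apply: (@cut_cone R (level n) J K (fun j => (j.1 * t j.2)%g) fst
  (fun k => (k.2 * level_gen n k.1)%g) snd) => B.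
pose F x : R := (x \in B)%:R.
have two : 1 <= 2 :> R by lra.
have pow2 (z : R) : `|z| `^ 2 = z ^+ 2.
  by rewrite powR_mulrn // -normrX ger0_norm // sqr_ge0.
have indic x y : `|F x - F y| = `|F x - F y| `^ 2.
  rewrite pow2 /F; case: (x \in B); case: (y \in B);
  by rewrite ?subrr ?subr0 ?sub0r ?normrN ?normr1 ?normr0 ?sqrrN ?expr1n ?expr0n.
rewrite -(pair_big xpredT xpredT (fun x a => `|F (x * t a)%g - F x|)) /=.
rewrite -(pair_big xpredT xpredT (fun i x => `|F (x * level_gen n i)%g - F x|)) /=.
under eq_bigr do under eq_bigr do rewrite indic.
under [X in _ <= _ * X]eq_bigr do under eq_bigr do rewrite indic.
apply: le_trans (sum_centered_dist F two) _.
pose u := centeredR F.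
have gap : \sum_x `|u x| `^ 2 <=
    40 * \sum_i \sum_x `|u (x * level_gen n i)%g - u x| `^ 2.
  under eq_bigr do rewrite pow2.
  under [X in _ <= _ * X]eq_bigr do under eq_bigr do rewrite pow2.
  exact: relative_gap (@centered_sum R n R^o F).
have := ler_sum (index_enum generator) (fun i (_ : true) => variation_centered two F i).
rewrite -mulr_sumr; move: gap; rewrite -/u.
have -> : 2 `^ 2 = 4 :> R by rewrite (powR_mulrn 2) //; lra.
set S := \sum_x _; set A := \sum_i _; set D := \sum_i _ => gap hA.
have -> : 6400 * N * D = 4 * 2 * N * (800 * D) by ring.
by rewrite ler_pM2l ?mulr_gt0 //; lra.
Qed.

Lemma card_generator : #|{: generator}| = 5%N.
Proof. by rewrite card_sum card_option !card_bool. Qed.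

(** A value of the centred function is a mean of its differences along the
    translations. *)
Lemma centered_power p f : 1 <= p -> \sum_x `|centeredR f x| `^ p <=
  2 `^ p / N * \sum_x \sum_a `|centeredR f (x * t a)%g - centeredR f x| `^ p.
Proof.
move=> p1; have p0 : 0 <= p by exact: le_trans p1.
rewrite mulrAC -mulrA mulr_suml mulr_sumr; apply: ler_sum => x _.
apply: le_trans (powR_mean p1 _ (card_plane_gt0 n)) => //.
apply: ge0_ler_powR => //; rewrite ?nnegrE ?divr_ge0 ?sumr_ge0 //.
rewrite ler_pdivlMr //; apply: le_trans (ler_norm_sum _ _ _).
rewrite sumrB centered_sum sub0r normrN sumr_const -[_ *+ #|_|]mulr_natr.
by rewrite normrM [`|N|]ger0_norm.
Qed.

End Gaps.

Section PowerGap.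
Variable R : realType.

(** Matousek's extrapolation: the inequality for the signed power of the
    centred function bounds its power sum by a small multiple of itself plus
    the variation. *)
Lemma gap_centered_Lp p : 1 <= p -> exists2 C : R, 0 <= C & forall n (f : level n -> R),
  \sum_x `|@centered R n R^o f x| `^ p <=
  C * \sum_i \sum_x `|f (x * level_gen n i)%g - f x| `^ p.
Proof.
move=> p1; have [q qE q1] : exists2 q : R, q = 2 `^ p & 1 <= q.
  by exists (2 `^ p) => //; exact: powR2_ge1.
have [M ME M1] : exists2 M : R, M = q * q * 6400 & 1 <= M.
  by exists (q * q * 6400) => //; nra.
(* This choice lets the first term of [upper] be absorbed: [M] times the sum
   over the five generators of [2 * e * S] is half of [S]. *)
have [e eM] : exists e : R, e * (20 * M) = 1.
  by exists (20 * M)^-1; rewrite mulVf // gt_eqF; lra.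
have e01 : 0 < e < 1 by apply/andP; split; nra.
have [C C0 upper] := signed_power_upper p1 e01.
exists (2 * M * C * (q * (1 + q))) => [|n f]; first by rewrite !mulr_ge0 //; lra.
have N0 : 0 < #|{: plane n}|%:R :> R by rewrite ltr0n card_plane_gt0.
set N : R := #|{: plane n}|%:R in N0; pose u := @centered R n R^o f.
set S := \sum_x _; set V := \sum_i _.
pose W := \sum_i \sum_x `|u (x * level_gen n i)%g - u x| `^ p.
pose phi x := signed_power p (u x).
have S0 : 0 <= S by apply: sumr_ge0 => x _; exact: powR_ge0.
have step1 : S <= M * \sum_i \sum_x `|phi (x * level_gen n i)%g - phi x|.
  apply: le_trans (centered_power f p1) _; rewrite -qE -/u -/N.
  have lower : \sum_x \sum_a `|u (x * level_trans a)%g - u x| `^ p <=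
      q * \sum_x \sum_a `|phi (x * level_trans a)%g - phi x|.
    rewrite mulr_sumr ler_sum // => x _; rewrite mulr_sumr ler_sum // => a _.
    by rewrite qE; exact: signed_power_lower.
  have := gap_L1 phi; rewrite -/N; set D := \sum_i _ => hD.
  have qN : 0 <= q / N by rewrite divr_ge0 // (le_trans ler01).
  apply: le_trans (ler_wpM2l qN lower) _; rewrite mulrA.
  have qqN : 0 <= q / N * q by rewrite mulr_ge0 // (le_trans ler01).
  apply: le_trans (ler_wpM2l qqN hD) _; rewrite ME.
  by rewrite le_eqVlt; apply/orP; left; apply/eqP; field; rewrite gt_eqF.
have step2 : \sum_i \sum_x `|phi (x * level_gen n i)%g - phi x| <=
    10 * e * S + C * W.
  apply: (@le_trans _ _ (\sum_i \sum_x (e * (`|u (x * level_gen n i)%g| `^ p + `|u x| `^ p)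
      + C * `|u (x * level_gen n i)%g - u x| `^ p))).
    by apply: ler_sum => i _; apply: ler_sum => x _; exact: upper.
  under eq_bigr do rewrite big_split -!mulr_sumr big_split /=.
  rewrite big_split -!mulr_sumr /= lerD2r.
  have sum_gen i : \sum_x `|u (x * level_gen n i)%g| `^ p = S.
    by rewrite /S [RHS](reindex_inj (mulIg (level_gen n i))).
  rewrite (eq_bigr (fun=> S + S)) => [|i _]; last by rewrite (sum_gen i) -/S.
  rewrite sumr_const card_generator -/S le_eqVlt; apply/orP; left; apply/eqP.
  by rewrite -[_ *+ 5]mulr_natr; ring.
have := ler_sum (index_enum generator) (fun i (_ : true) => variation_centered p1 f i).
rewrite -mulr_sumr -qE -/V -/u; rewrite -/W => step3.
have M0 : 0 <= M := le_trans ler01 M1.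
have step4 := le_trans step1 (ler_wpM2l M0 step2).
have step5 : M * C * W <= M * C * (q * (1 + q) * V).
  by apply: ler_wpM2l step3; exact: mulr_ge0.
have half : M * (10 * e * S + C * W) = e * (20 * M) * (S / 2) + M * C * W by field.
rewrite half eM mul1r in step4.
have -> : 2 * M * C * (q * (1 + q)) * V = 2 * (M * C * (q * (1 + q) * V)) by ring.
apply: le_trans (ler_wpM2l _ step5); last by [].
by move: step4; clear; move: (M * C * W) S => Z S; lra.
Qed.

Lemma gap_Lp p : 1 <= p -> exists2 C : R, 0 <= C & forall n (f : level n -> R),
  \sum_x \sum_a `|f (x * level_trans a)%g - f x| `^ p <=
  C * #|{: plane n}|%:R * \sum_i \sum_x `|f (x * level_gen n i)%g - f x| `^ p.
Proof.
move=> p1; have [C C0 hC] := gap_centered_Lp p1.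
exists (2 `^ p * 2 * C) => [|n f]; first by rewrite !mulr_ge0 // powR_ge0.
apply: le_trans (sum_centered_dist f p1) _.
rewrite [2 `^ p * 2 * C * _]mulrAC -[leRHS]mulrA ler_wpM2l ?hC //.
Qed.

End PowerGap.

(** * Smoothing operators *)

Section Smoothing.
Variables (R : realType) (n : nat) (V : lmodType R).
Implicit Types (f g : level n -> V) (x : level n).

(** The identity is averaged along with the generators, which keeps -1 away
    from the spectrum. *)
Definition avg f x : V := 6%:R^-1 *: (f x + \sum_i f (x * level_gen n i)%g).

Definition smooth k f : level n -> V := iter k avg f.

Lemma mean_linear b f g :
  mean (fun x => b *: f x + g x) = fun x => b *: mean f x + mean g x.
Proof.
apply: boolp.funext => x; rewrite /mean big_split /= -scaler_sumr scalerDr !scalerA.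
by rewrite [b * _]mulrC.
Qed.

Lemma avg_linear b f g :
  avg (fun x => b *: f x + g x) = fun x => b *: avg f x + avg g x.
Proof.
apply: boolp.funext => x; rewrite /avg big_split /= -scaler_sumr addrACA -scalerDr.
by rewrite [LHS]scalerDr !scalerA [b * _]mulrC.
Qed.

Lemma smooth_linear k b f g :
  smooth k (fun x => b *: f x + g x) = fun x => b *: smooth k f x + smooth k g x.
Proof. by elim: k => //= k ->; rewrite avg_linear. Qed.

Lemma centered_linear b f g :
  centered (fun x => b *: f x + g x) = fun x => b *: centered f x + centered g x.
Proof.
by apply: boolp.funext => x; rewrite /centered mean_linear scalerBr opprD addrACA.
Qed.

Lemma avgB f g : avg (fun x => f x - g x) = fun x => avg f x - avg g x.
Proof.
have := avg_linear (-1) g f; rewrite (_ : (fun x => _) = fun x => f x - g x); last first.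
  by apply: boolp.funext => x; rewrite scaleN1r addrC.
by move=> ->; apply: boolp.funext => x; rewrite scaleN1r addrC.
Qed.

Lemma mean_avg f x : mean (avg f) x = avg (mean f) x.
Proof.
rewrite /avg; under [in RHS]eq_bigr do rewrite -mean_gen.
rewrite /mean -scaler_sumr scalerA mulrC -scalerA; congr (_ *: _).
by rewrite big_split exchange_big scalerDr /= -scaler_sumr.
Qed.

Lemma centered_avg f : centered (avg f) = avg (centered f).
Proof.
by rewrite /centered avgB; apply: boolp.funext => x; rewrite mean_avg.
Qed.

Lemma mean_smooth k f x : (forall y, mean f y = 0) -> mean (smooth k f) x = 0.
Proof.
move=> f0; elim: k x => [|k IHk] x /=; first exact: f0.
rewrite mean_avg /avg IHk add0r big1 ?scaler0 // => i _; exact: IHk.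
Qed.

(** The factor 1/2 compensates the norm of centring on L1 and Loo. *)
Definition smoothing k f x : V := 2^-1 *: smooth k (centered f) x.

Lemma smoothing_linear k b f g :
  smoothing k (fun x => b *: f x + g x) = fun x => b *: smoothing k f x + smoothing k g x.
Proof.
apply: boolp.funext => x; rewrite /smoothing centered_linear smooth_linear.
by rewrite scalerDr !scalerA [b * _]mulrC.
Qed.

End Smoothing.

Lemma smoothing_tensor (R : realType) n (V : lmodType R) k (f : level n -> R) (v : V) :
  smoothing k (fun x => f x *: v) = fun x => (@smoothing R n R^o k f x : R) *: v.
Proof.
have cE : centered (fun x => f x *: v) = fun x => (@centered R n R^o f x : R) *: v.
  apply: boolp.funext => x; rewrite /centered /mean -scaler_suml scalerA scalerBl.
  by [].
have sE : smooth k (fun x => (@centered R n R^o f x : R) *: v) =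
    fun x => (@smooth R n R^o k (@centered R n R^o f) x : R) *: v.
  elim: k => //= k ->; apply: boolp.funext => x.
  by rewrite /avg -scaler_suml -scalerDl scalerA.
by apply: boolp.funext => x; rewrite /smoothing cE sE scalerA.
Qed.

Section SmoothingNorm.
Variables (R : realType) (n : nat) (V : normedModType R).
Implicit Types (f g : level n -> V) (x : level n) (b : R).

Lemma norm_mean_le f b : (forall x, `|f x| <= b) -> forall x, `|mean f x| <= b.
Proof.
move=> fb x; have N0 : 0 < #|{: plane n}|%:R :> R by rewrite ltr0n card_plane_gt0.
rewrite normrZ normfV ger0_norm // mulrC ler_pdivrMr //.
apply: le_trans (ler_norm_sum _ _ _) _; apply: le_trans (ler_sum _ (fun a _ => fb _)) _.
by rewrite sumr_const -[_ *+ #|_|]mulr_natr.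
Qed.

Lemma norm_avg_le f b : (forall x, `|f x| <= b) -> forall x, `|avg f x| <= b.
Proof.
move=> fb x; rewrite normrZ normfV ger0_norm // mulrC ler_pdivrMr //.
apply: le_trans (ler_normD _ _) _.
have : `|\sum_i f (x * level_gen n i)%g| <= b *+ 5.
  apply: le_trans (ler_norm_sum _ _ _) _; apply: le_trans (ler_sum _ (fun a _ => fb _)) _.
  by rewrite sumr_const card_generator.
by have := fb x; rewrite -mulr_natr; lra.
Qed.

Lemma norm_centered_le f b : (forall x, `|f x| <= b) -> forall x, `|centered f x| <= 2 * b.
Proof.
move=> fb x; apply: le_trans (ler_normB _ _) _.
by have := fb x; have := norm_mean_le fb x; lra.
Qed.

Lemma norm_smooth_le k f b : (forall x, `|f x| <= b) -> forall x, `|smooth k f x| <= b.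
Proof. by move=> fb; elim: k => //= k IHk; exact: norm_avg_le. Qed.

Lemma norm_smoothing_le k f b : (forall x, `|f x| <= b) -> forall x, `|smoothing k f x| <= b.
Proof.
move=> fb x; rewrite normrZ ger0_norm ?invr_ge0 //.
have := norm_smooth_le k (norm_centered_le fb) x; lra.
Qed.

(** Averaging commutes with centring, so the distance telescopes into [k] terms,
    each the average of a centred function bounded by [2 * b]. *)
Lemma norm_smooth_dist k f b :
  (forall x i, `|f (x * level_gen n i)%g - f x| <= b) ->
  forall x, `|centered f x - smooth k (centered f) x| <= k%:R * (2 * b).
Proof.
move=> fb; have b0 : 0 <= b by apply: le_trans (fb 1%g (inr true)).
have fa x : `|f x - avg f x| <= b.
  have -> : f x - avg f x = 6%:R^-1 *: - \sum_i (f (x * level_gen n i)%g - f x).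
    apply: (@scalerI _ _ 6%:R); first by rewrite pnatr_eq0.
    rewrite scalerBr !scalerA mulfV ?pnatr_eq0 // !scale1r sumrB sumr_const.
    by rewrite card_generator opprB opprD addrA scaler_nat (mulrSr _ 5) addrK.
  rewrite normrZ normfV ger0_norm // mulrC ler_pdivrMr // normrN.
  apply: le_trans (ler_norm_sum _ _ _) _; apply: le_trans (ler_sum _ (fun a _ => fb _ _)) _.
  by rewrite sumr_const card_generator -mulr_natr; lra.
have ca x : `|centered f x - avg (centered f) x| <= 2 * b.
  rewrite -centered_avg.
  have -> : centered f x - centered (avg f) x = centered (fun y => f y - avg f y) x.
    rewrite /centered meanB !opprB [LHS]addrACA [RHS]addrACA.
    by congr (_ + _); exact: addrC.
  exact: norm_centered_le.
elim: k => [|k IHk] x; first by rewrite subrr normr0 mul0r.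
rewrite -natr1 mulrDl mul1r.
have -> : centered f x - smooth k.+1 (centered f) x =
    avg (fun y => centered f y - smooth k (centered f) y) x
    + (centered f x - avg (centered f) x).
  by rewrite avgB /= [RHS]addrC addrA subrK.
by apply: le_trans (ler_normD _ _) (lerD (norm_avg_le IHk x) (ca x)).
Qed.

End SmoothingNorm.

Section ScalarSmoothing.
Variables (R : realType) (n : nat).
Implicit Types (f : level n -> R^o) (x : level n).

Let N0 : 0 < #|{: plane n}|%:R :> R.
Proof. by rewrite ltr0n card_plane_gt0. Qed.

Let sum_translate (F : level n -> R) (g : level n) : \sum_x F (x * g)%g = \sum_x F x.
Proof. by rewrite [RHS](reindex_inj (mulIg g)). Qed.

Lemma sum_norm_mean f : \sum_x `|mean f x| <= \sum_x `|f x|.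
Proof.
apply: (@le_trans _ _ (\sum_x #|{: plane n}|%:R^-1 * \sum_a `|f (x * level_trans a)%g|)).
  apply: ler_sum => x _; rewrite normrZ normfV ger0_norm //.
  by rewrite ler_wpM2l ?invr_ge0 // ler_norm_sum.
rewrite -mulr_sumr exchange_big (eq_bigr (fun=> \sum_x `|f x|)) => [|a _].
  by rewrite sumr_const -[(\sum_x _) *+ _]mulr_natl mulKf // gt_eqF.
exact: (sum_translate (fun x => `|f x|)).
Qed.

Lemma sum_norm_avg f : \sum_x `|avg f x| <= \sum_x `|f x|.
Proof.
apply: (@le_trans _ _ (\sum_x 6%:R^-1 * (`|f x| + \sum_i `|f (x * level_gen n i)%g|))).
  apply: ler_sum => x _; rewrite normrZ normfV ger0_norm //.
  rewrite ler_wpM2l ?invr_ge0 // (le_trans (ler_normD _ _)) // lerD2l.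
  exact: ler_norm_sum.
rewrite -mulr_sumr big_split exchange_big /= [X in _ + X](eq_bigr (fun=> \sum_x `|f x|)).
  by rewrite sumr_const card_generator -mulrS -[(\sum_x _) *+ _]mulr_natl mulKf.
by move=> i _; exact: (sum_translate (fun x => `|f x|)).
Qed.

Lemma sum_norm_smoothing k f : \sum_x `|smoothing k f x| <= \sum_x `|f x|.
Proof.
have smooth_le (g : level n -> R^o) : \sum_x `|smooth k g x| <= \sum_x `|g x|.
  by elim: k => //= k; apply: le_trans (sum_norm_avg _).
have c2 : \sum_x `|centered f x| <= 2 * \sum_x `|f x|.
  apply: (@le_trans _ _ (\sum_x (`|f x| + `|mean f x|))).
    by apply: ler_sum => x _; exact: ler_normB.
  by rewrite big_split /=; have := sum_norm_mean f; lra.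
under eq_bigr do rewrite normrZ ger0_norm ?invr_ge0 //.
rewrite -mulr_sumr; have := le_trans (smooth_le _) c2; lra.
Qed.

Let sqr_sum_generator (z : generator -> R) : (\sum_i z i) ^+ 2 <= 5 * \sum_i z i ^+ 2.
Proof.
set s := \sum_i z i.
have : 0 <= \sum_i (z i - s / 5) ^+ 2 by apply: sumr_ge0 => i _; exact: sqr_ge0.
rewrite (eq_bigr (fun i => z i ^+ 2 + (- 2 * s / 5 * z i + (s / 5) ^+ 2))); last first.
  by move=> i _; field.
rewrite !big_split -mulr_sumr /= -/s sumr_const card_generator -[(s / 5) ^+ 2 *+ 5]mulr_natl.
have -> : 5%:R * (s / 5) ^+ 2 = s ^+ 2 / 5 by field.
have -> : - 2 * s / 5 * s = - 2 * s ^+ 2 / 5 by field.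
lra.
Qed.

(** The squared norm of an average of isometric images falls short of the
    squared norm by the distances between these images, which the relative gap
    bounds from below. *)
Lemma sum_sqr_avg f : (forall x, mean f x = 0) ->
  \sum_x (avg f x : R) ^+ 2 <= 1439 / 1440 * \sum_x f x ^+ 2.
Proof.
move=> f0; have sum0 x : \sum_a f (x * level_trans a)%g = 0.
  have /eqP := f0 x; rewrite scaler_eq0 invr_eq0 gt_eqF //=.
  by move=> /eqP.
have := relative_gap sum0; set S := \sum_x _; set D := \sum_i _ => gap.
have pointwise x : 36 * (avg f x : R) ^+ 2 <=
    6 * (f x ^+ 2 + \sum_i f (x * level_gen n i)%g ^+ 2)
    - \sum_i (f (x * level_gen n i)%g - f x) ^+ 2.
  have -> : avg f x = 6%:R^-1 * (f x + \sum_i f (x * level_gen n i)%g) :> R by [].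
  set z := fun i => f (x * level_gen n i)%g; have := sqr_sum_generator z.
  rewrite [\sum_i (_ - _) ^+ 2](eq_bigr (fun i => z i ^+ 2 + (- 2 * f x * z i + f x ^+ 2))).
    rewrite !big_split -mulr_sumr /= sumr_const card_generator -[f x ^+ 2 *+ 5]mulr_natl.
    set s := \sum_i z i; set q := \sum_i _.
    have -> : 36 * (6%:R^-1 * (f x + s)) ^+ 2 = (f x + s) ^+ 2 by field.
    by move: (f x : R) => b; nra.
  by move=> i _; rewrite /z; ring.
have := ler_sum (index_enum (level n)) (fun x (_ : true) => pointwise x).
rewrite -mulr_sumr sumrB -mulr_sumr big_split /=.
have -> : \sum_x \sum_i f (x * level_gen n i)%g ^+ 2 = 5 * S.
  rewrite exchange_big /= (eq_bigr (fun=> S)) => [|i _].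
    by rewrite sumr_const card_generator mulr_natl.
  exact: (sum_translate (fun x => f x ^+ 2)).
have -> : \sum_x \sum_i (f (x * level_gen n i)%g - f x) ^+ 2 = D by exact: exchange_big.
rewrite -/S; set A := \sum_x _; lra.
Qed.

Lemma sum_sqr_smoothing k f :
  \sum_x (smoothing k f x : R) ^+ 2 <= (1439 / 1440) ^+ k * \sum_x f x ^+ 2.
Proof.
pose u := centered f.
have u0 x : mean u x = 0 by rewrite /mean centered_sum scaler0.
have cu : \sum_x (u x : R) ^+ 2 <= 4 * \sum_x f x ^+ 2.
  apply: (@le_trans _ _ (\sum_x (2 * f x ^+ 2 + 2 * (mean f x : R) ^+ 2))).
    apply: ler_sum => x _; rewrite /u /centered; move: (f x : R) (mean f x : R) => b c.
    have := sqr_ge0 (b + c); nra.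
  rewrite big_split -!mulr_sumr /=.
  suff : \sum_x (mean f x : R) ^+ 2 <= \sum_x f x ^+ 2 by lra.
  have mean0 : 0 <= \sum_x
      (#|{: plane n}|%:R^-1 * \sum_a (f (x * level_trans a)%g - mean f x) ^+ 2).
    apply: sumr_ge0 => x _; rewrite mulr_ge0 ?invr_ge0 // sumr_ge0 // => a _.
    exact: sqr_ge0.
  have expand x : #|{: plane n}|%:R^-1 * \sum_a (f (x * level_trans a)%g - mean f x) ^+ 2 =
      #|{: plane n}|%:R^-1 * \sum_a f (x * level_trans a)%g ^+ 2 - (mean f x : R) ^+ 2.
    have mE : \sum_a f (x * level_trans a)%g = #|{: plane n}|%:R * (mean f x : R).
      by apply/esym; apply: mulVKf; rewrite gt_eqF.
    move: (mean f x : R) mE => m mE.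
    rewrite (eq_bigr (fun a => f (x * level_trans a)%g ^+ 2
      + (- 2 * m * f (x * level_trans a)%g + m ^+ 2))); last by move=> a _; ring.
    rewrite !big_split -mulr_sumr /= mE sumr_const -[m ^+ 2 *+ _]mulr_natl.
    by field; rewrite gt_eqF.
  move: mean0; rewrite (eq_bigr _ (fun x _ => expand x)) sumrB -mulr_sumr exchange_big /=.
  rewrite (eq_bigr (fun=> \sum_x f x ^+ 2)) => [|a _]; last first.
    exact: (sum_translate (fun x => f x ^+ 2)).
  by rewrite sumr_const -[(\sum_x _) *+ _]mulr_natl mulKf ?gt_eqF // subr_ge0.
have [c cE c0] : exists2 c : R, c = 1439 / 1440 & 0 < c.
  by exists (1439 / 1440); [reflexivity|lra].
rewrite -cE; have smooth_sqr : \sum_x (smooth k u x : R) ^+ 2 <=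
    c ^+ k * \sum_x (u x : R) ^+ 2.
  elim: k => [|k IHk]; first by rewrite expr0 mul1r.
  have := @sum_sqr_avg (smooth k u) (fun x => @mean_smooth R n R^o k u x u0).
  by rewrite -cE exprS -mulrA => /le_trans; apply; rewrite ler_pM2l.
under eq_bigr do rewrite exprMn.
rewrite -mulr_sumr; have ck0 : 0 <= c ^+ k by rewrite exprn_ge0 // ltW.
have := ler_wpM2l ck0 cu; move: smooth_sqr; clear; move: (c ^+ k) => {}c.
set A := \sum_x _; set B := \sum_x _; set D := \sum_x _ => h1 h2.
have -> : 2^-1 ^+ 2 = 4^-1 :> R by field.
move: h1 h2; rewrite mulrCA; move: (c * B) (c * D) => b d; lra.
Qed.

End ScalarSmoothing.

(** * Cuts and neighbourhoods in expanders *)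

Section Cheeger.
Variables (R : realType) (X : graph) (c : R).
Hypothesis c0 : 0 < c.
Hypothesis cX : (c%:E <= cheeger R X)%E.
Implicit Types (A B : {set X}).

Lemma edge_boundaryC A : #|edge_boundary (~: A)%SET| = #|edge_boundary A|.
Proof.
pose swap (u : X * X) := (u.2, u.1).
have swapK : involutive swap by case.
rewrite -(card_imset _ (inv_inj swapK)); apply: eq_card => -[x y].
apply/imsetP/idP => [[[u v]]|].
  by rewrite !inE /= negbK => /and3P[vA uA uv] [-> ->]; rewrite uA vA adj_sym.
by rewrite !inE /= => /and3P[xA yA xy]; exists (y, x); rewrite // !inE /= negbK yA xA adj_sym.
Qed.

(** The product form treats a set and its complement alike, whichever of them
    is the smaller. *)
Lemma cheeger_cut A : c * #|A|%:R * #|(~: A)%SET|%:R <= #|X|%:R * #|edge_boundary A|%:R.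
Proof.
have small B : (#|B|.*2 <= #|X|)%N -> c * #|B|%:R <= #|edge_boundary B|%:R.
  have [->|B0] := eqVneq B finset.set0; first by rewrite cards0 mulr0.
  move=> BX; have B1 : (1 <= #|B|)%N by rewrite card_gt0.
  have : (c%:E <= (#|edge_boundary B|%:R / #|B|%:R)%:E)%E.
    by apply: le_trans cX _; apply: bigmin_le_cond; rewrite B1.
  by rewrite lee_fin ler_pdivlMr // ltr0n.
have cardX B : #|B|%:R <= #|X|%:R :> R by rewrite ler_nat max_card.
have [AX|AX] := leqP #|A|.*2 #|X|.
  by rewrite mulrC; apply: ler_pM; rewrite ?mulr_ge0 ?(ltW c0) ?small.
rewrite mulrAC mulrC -edge_boundaryC; apply: ler_pM; rewrite ?mulr_ge0 ?(ltW c0) ?small //.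
by move: AX; rewrite -(finset.cardsC A) -!addnn ltn_add2l leq_add2r => /ltnW.
Qed.

Definition neighbourhood B : {set X} := (B :|: [set y | [exists x in B, adj x y]])%SET.

Variable D : nat.
Hypothesis XD : forall x : X, (#|[set y | adj x y]%SET| <= D)%N.

Lemma edge_boundary_neighbourhood B :
  (#|edge_boundary B| <= D * #|(neighbourhood B :\: B)%SET|)%N.
Proof.
rewrite -sum1_card (partition_big snd [in (neighbourhood B :\: B)%SET]) /=.
  rewrite mulnC -sum_nat_const; apply: leq_sum => y _.
  rewrite sum1_card; apply: leq_trans (XD y).
  rewrite -(card_in_imset (f := fst : X * X -> X)).
    apply/subset_leq_card/fintype.subsetP => x /imsetP[[x' y']].
    rewrite unfold_in /= => /andP[xy /eqP<-] ->; move: xy.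
    by rewrite !inE /= adj_sym => /and3P[].
  move=> [x y1] [x' y2]; rewrite !unfold_in /=.
  by move=> /andP[_ /eqP->] /andP[_ /eqP->] ->.
move=> [x y]; rewrite !inE /= => /and3P[xB yB xy]; rewrite yB orbC /=.
by apply/orP; left; apply/existsP; exists x; rewrite xB.
Qed.

(** As long as neither the set nor its complement is small, each step adds a
    fixed proportion of the vertices, which bounds the number of steps. *)
Lemma neighbourhood_growth B (eta : R) r : 0 < eta -> (0 < #|X|)%N ->
  eta * #|X|%:R <= #|B|%:R -> eta * #|X|%:R <= #|(~: iter r neighbourhood B)%SET|%:R ->
  r%:R * (c * eta ^+ 2) <= D%:R.
Proof.
move=> eta0 X0 hB hr; have X0' : 0 < #|X|%:R :> R by rewrite ltr0n.
have sub_iter k : B \subset iter k neighbourhood B.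
  by elim: k => //= k IHk; apply: (fintype.subset_trans IHk); exact: finset.subsetUl.
have sub_step A : A \subset neighbourhood A by exact: finset.subsetUl.
have sub_r k : (k <= r)%N -> iter k neighbourhood B \subset iter r neighbourhood B.
  move=> /subnK <-; elim: (r - k)%N => //= j IHj.
  exact: (fintype.subset_trans IHj).
have step k : (k < r)%N -> c * eta ^+ 2 * #|X|%:R <=
    D%:R * (#|iter k.+1 neighbourhood B|%:R - #|iter k neighbourhood B|%:R).
  move=> kr; set A := iter k neighbourhood B.
  have A1 : eta * #|X|%:R <= #|A|%:R.
    by apply: le_trans hB _; rewrite ler_nat subset_leq_card // sub_iter.
  have A2 : eta * #|X|%:R <= #|(~: A)%SET|%:R.
    apply: le_trans hr _; rewrite ler_nat subset_leq_card // finset.setCS sub_r //.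
    exact: ltnW.
  have dA : #|edge_boundary A|%:R <= D%:R * (#|neighbourhood A|%:R - #|A|%:R) :> R.
    have -> : #|neighbourhood A|%:R - #|A|%:R = #|(neighbourhood A :\: A)%SET|%:R :> R.
      rewrite cardsD (finset.setIidPr (sub_step A)) natrB //.
      by rewrite subset_leq_card.
    by rewrite -natrM ler_nat edge_boundary_neighbourhood.
  apply: le_trans dA; rewrite -(ler_pM2l X0').
  apply: le_trans (cheeger_cut A).
  have -> : #|X|%:R * (c * eta ^+ 2 * #|X|%:R) =
    c * (eta * #|X|%:R) * (eta * #|X|%:R) by ring.
  have e0 : 0 <= eta * #|X|%:R by rewrite mulr_ge0 // ltW.
  by apply: ler_pM => //; [rewrite mulr_ge0 // ltW|rewrite ler_pM2l].
have total k : (k <= r)%N -> k%:R * (c * eta ^+ 2 * #|X|%:R) <=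
    D%:R * #|iter k neighbourhood B|%:R.
  elim: k => [|k IHk] kr; first by rewrite mul0r mulr_ge0.
  have := step k kr; have := IHk (ltnW kr).
  rewrite -natr1 mulrDl mul1r mulrBr; lra.
have := total r (leqnn r); rewrite mulrA -mulrA -mulrA.
have : D%:R * #|iter r neighbourhood B|%:R <= D%:R * #|X|%:R :> R.
  by rewrite ler_wpM2l // ler_nat max_card.
move=> h1 h2; rewrite -(ler_pM2r X0'); apply: le_trans h1.
by apply: le_trans h2; rewrite !mulrA.
Qed.

End Cheeger.

(** * Walls *)

Lemma card_generated_involutions (gT : finGroupType) (T : {set gT}) :
  {in T &, forall g h, commute g h} -> {in T, forall g, g * g = 1}%g ->
  (#|<<T>>%g| <= 2 ^ #|T|)%N.
Proof.
have [m] := ubnP #|T|; elim: m T => // m IHm T; rewrite ltnS => Tm comm invol.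
have [->|[x xT]] := set_0Vmem T; first by rewrite gen0 cards1 expn_gt0.
have sT : (T :\ x)%SET \subset T by exact: subD1set.
have cardT : #|T| = #|(T :\ x)%SET|.+1 by rewrite (cardsD1 x T) xT.
have IH : (#|<<(T :\ x)%SET>>%g| <= 2 ^ #|(T :\ x)%SET|)%N.
  apply: IHm; first by rewrite -cardT.
  - by move=> g h /(fintype.subsetP sT) gT' /(fintype.subsetP sT); exact: comm.
  - by move=> g /(fintype.subsetP sT); exact: invol.
have cyc : (#|<[x]>%g| <= 2)%N.
  by rewrite dvdn_leq // order_dvdn expgS expg1 invol.
have -> : <<T>>%g = (<[x]> * <<(T :\ x)%SET>>)%g.
  rewrite -cent_joinEl; last first.
    rewrite cycle_subG /= cent_gen; apply/centP => g /(fintype.subsetP sT).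
    exact: comm.
  by rewrite joing_idl joing_idr -[in LHS](finset.setD1K xT).
rewrite cardT expnS; apply: leq_trans (leq_mul cyc IH).
by rewrite (mul_cardG <[x]> <<(T :\ x)%SET>>) leq_pmulr // cardG_gt0.
Qed.

(** A family of least cardinality among those of weight at least [q] has weight
    at most [2 * q]. *)
Lemma split_weights (R : realDomainType) (J : finType) (w : J -> R) (q : R) :
  (forall j, 0 <= w j <= q) -> 3 * q <= \sum_j w j ->
  exists P : {set J}, q <= \sum_(j in P) w j /\ q <= \sum_(j in (~: P)%SET) w j.
Proof.
move=> wq hq; have w0 j : 0 <= w j by case/andP: (wq j).
pose W (P : {set J}) := \sum_(j in P) w j.
have WC P : W P + W (~: P)%SET = \sum_j w j.
  rewrite /W [RHS](bigID (mem P)) /=; congr (_ + _); apply: eq_bigl => j.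
  by rewrite finset.in_setC.
have W0 P : 0 <= W P by apply: sumr_ge0.
have [q0|q0] := leP q 0.
  by exists finset.set0; split; apply: (le_trans q0); exact: W0.
have total : q <= W [set: J]%SET.
  by rewrite /W (eq_bigl xpredT) => [|j]; [lra|rewrite finset.in_setT].
case: (@arg_minnP _ [set: J]%SET (fun P => q <= W P) (fun P => #|P|) total) => P qP Pmin.
exists P; split=> //.
have [P0|[j jP]] := set_0Vmem P; first by move: qP; rewrite P0 /W big_set0; lra.
have small : W (P :\ j)%SET < q.
  rewrite ltNge; apply/negP => /Pmin; by rewrite (cardsD1 j P) jP ltnn.
have WP : W P = w j + W (P :\ j)%SET by rewrite /W (big_setD1 j).
have /andP[_ wj] := wq j; have := WC P; rewrite -/(W _); lra.
Qed.

Section Walls.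
Variable n : nat.
Local Notation ev w := (\prod_(i <- w) level_gen n i)%g.

Definition wall_dist (g h : level n) : nat := #|[set e | g.2.1 e != h.2.1 e]|.

Lemma wall_dist_triangle g h k : (wall_dist g k <= wall_dist g h + wall_dist h k)%N.
Proof.
apply: leq_trans (leq_card_setU _ _); apply/subset_leq_card/fintype.subsetP => e.
by rewrite !inE; case: (g.2.1 e); case: (h.2.1 e); case: (k.2.1 e).
Qed.

Lemma wall_dist_word g w : (wall_dist g (g * ev w)%g <= 2 * size w)%N.
Proof.
elim/last_ind: w => [|w i IHw].
  by rewrite big_nil mulg1 /wall_dist (_ : [set e | _] = finset.set0) ?cards0 //;
    apply/setP => e; rewrite !inE eqxx.
rewrite -cats1 big_cat big_seq1 mulgA size_cat addn1 mulnS addnC.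
by apply: leq_trans (wall_dist_triangle _ (g * ev w)%g _) _; rewrite leq_add ?wall_gen.
Qed.

End Walls.

Local Open Scope classical_set_scope.

(** * Box spaces from towers of marked finite groups *)

Lemma leastP (P : set nat) n : P n -> P (least P) /\ (least P <= n)%N.
Proof.
move=> Pn; have exP : exists k, `[< P k >] by exists n; apply/asboolP.
have [k /asboolP Pk kmin] := ex_minnP exP.
have [Pl lmin] : [set n | P n /\ forall m, P m -> (n <= m)%N] (least P).
  by apply: (@xgetPex _ 0%N); exists k; split=> // m Pm; apply: kmin; apply/asboolP.
by split=> //; exact: lmin.
Qed.

Section MarkedTower.
Local Open Scope group_scope.
Variables (I : finType) (H : nat -> finGroupType) (h : forall n, I -> H n).
Hypothesis hK : forall n i, h n i * h n i = 1.
Hypothesis nested : forall n (w : seq I),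
  \prod_(i <- w) h n.+1 i = 1 -> \prod_(i <- w) h n i = 1.

Definition eval n (w : seq I) : H n := \prod_(i <- w) h n i.

Lemma eval_cat n v w : eval n (v ++ w) = eval n v * eval n w.
Proof. exact: big_cat. Qed.

(** The generators are involutions, so that words without inverses suffice
    and reversing a word inverts its value. *)
Lemma eval_rev n w : eval n (rev w) = (eval n w)^-1.
Proof.
elim: w => [|i w IHw]; first by rewrite /eval big_nil invg1.
rewrite rev_cons -cats1 eval_cat IHw /eval big_seq1 big_cons invMg; congr (_ * _).
by apply/eqP; rewrite eq_sym eq_invg_mul hK.
Qed.

(** The group is defined by equality of values at all levels, so that the
    kernels of the levels intersect trivially by construction. *)
Definition word_rel : rel (seq I) :=
  fun v w => `[< forall n, eval n v = eval n w >].

Lemma word_rel_refl : reflexive word_rel.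
Proof. by move=> v; apply/asboolP. Qed.
Lemma word_rel_sym : symmetric word_rel.
Proof. by move=> v w; apply/asboolP/asboolP => vw n; rewrite vw. Qed.
Lemma word_rel_trans : transitive word_rel.
Proof.
by move=> v u w /asboolP uv /asboolP vw; apply/asboolP => n; rewrite uv vw.
Qed.

Canonical word_rel_equiv :=
  EquivRel word_rel word_rel_refl word_rel_sym word_rel_trans.

Definition word_group : Type := {eq_quot word_rel}%qT.
HB.instance Definition _ := Choice.on word_group.
HB.instance Definition _ := EqQuotient.on word_group.

Definition of_word (w : seq I) : word_group := (\pi_word_group w)%qT.

Definition value n (a : word_group) : H n := eval n (generic_quotient.repr a).

Lemma value_of_word n w : value n (of_word w) = eval n w.
Proof.
have /eqmodP/asboolP/(_ n)// : of_word (generic_quotient.repr (of_word w)) = of_word w.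
exact: reprK.
Qed.

Lemma value_inj a b : (forall n, value n a = value n b) -> a = b.
Proof.
by move=> ab; rewrite -[a]reprK -[b]reprK; apply/eqmodP/asboolP.
Qed.

Let wmul (a b : word_group) := of_word (generic_quotient.repr a ++ generic_quotient.repr b).
Let wone : word_group := of_word [::].
Let winv (a : word_group) := of_word (rev (generic_quotient.repr a)).

Let valueM' n a b : value n (wmul a b) = value n a * value n b.
Proof. by rewrite value_of_word eval_cat. Qed.
Let value1' n : value n wone = 1.
Proof. by rewrite value_of_word /eval big_nil. Qed.
Let valueV' n a : value n (winv a) = (value n a)^-1.
Proof. by rewrite value_of_word eval_rev. Qed.

Let wmulA : associative wmul.
Proof. by move=> a b c; apply: value_inj => n; rewrite !valueM' mulgA. Qed.
Let wmul1 : left_id wone wmul.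
Proof. by move=> a; apply: value_inj => n; rewrite valueM' value1' mul1g. Qed.
Let wmulr1 : right_id wone wmul.
Proof. by move=> a; apply: value_inj => n; rewrite valueM' value1' mulg1. Qed.
Let wmulV : left_inverse wone winv wmul.
Proof. by move=> a; apply: value_inj => n; rewrite valueM' valueV' mulVg value1'. Qed.
Let wmulrV : right_inverse wone winv wmul.
Proof. by move=> a; apply: value_inj => n; rewrite valueM' valueV' mulgV value1'. Qed.

HB.instance Definition _ := isGroup.Build word_group wmulA wmul1 wmulr1 wmulV wmulrV.

Lemma valueM n (a b : word_group) : value n (a * b) = value n a * value n b.
Proof. exact: valueM'. Qed.
Lemma value1 n : value n 1 = 1.
Proof. exact: value1'. Qed.
Lemma valueV n (a : word_group) : value n a^-1 = (value n a)^-1.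
Proof. exact: valueV'. Qed.

Lemma of_word_prod w : of_word w = \prod_(i <- w) of_word [:: i].
Proof.
apply: value_inj => n; rewrite (big_morph _ (valueM n) (value1 n)) value_of_word.
by apply: eq_bigr => i _; rewrite value_of_word /eval big_seq1.
Qed.

Definition level_kernel n : {pred word_group} :=
  if n is m.+1 then [pred a | value m a == 1] else predT.

Lemma level_kernel_group n : group_closed (level_kernel n).
Proof.
case: n => [|n]; first by split.
split; first by rewrite inE value1.
by move=> a b /eqP a1 /eqP b1; rewrite inE /= valueM valueV a1 b1 mulgV.
Qed.

Lemma level_kernel_conj n a b :
  a \in level_kernel n -> a ^ b \in level_kernel n.
Proof.
case: n => [//|n]; rewrite !inE => /eqP a1.
by rewrite /conjg !valueM valueV a1 mul1g mulVg.
Qed.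

Definition kernel_subgroup n := NormalSubgroup (@level_kernel_group n) (@level_kernel_conj n).

Definition marking : set word_group := range (fun i => of_word [:: i]).

Let piece n := Defs.quotient_group (kernel_subgroup n).

Definition piece_value n (x : piece n.+1) : H n := value n (generic_quotient.repr x).

Lemma piece_value_proj n (a : word_group) :
  piece_value (quot_proj (kernel_subgroup n.+1) a) = value n a.
Proof.
have /quot_projP := quot_proj_repr (quot_proj (kernel_subgroup n.+1) a).
by rewrite !inE /= valueM valueV -eq_mulVg1 => /eqP.
Qed.

Lemma piece_ind n (Q : piece n -> Prop) :
  (forall a, Q (quot_proj (kernel_subgroup n) a)) -> forall x, Q x.
Proof. by move=> Qa x; rewrite -(quot_proj_repr x). Qed.

Lemma piece_value_inj n : injective (@piece_value n).
Proof.
elim/piece_ind => a; elim/piece_ind => b; rewrite !piece_value_proj => ab.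
by apply/quot_projP; rewrite !inE /= valueM valueV ab mulVg.
Qed.

Lemma piece_valueM n (x y : piece n.+1) :
  piece_value (x * y) = piece_value x * piece_value y.
Proof.
elim/piece_ind: x => a; elim/piece_ind: y => b.
by rewrite [_ * _]quot_mulE !piece_value_proj valueM.
Qed.

Lemma piece_value1 n : piece_value (1 : piece n.+1) = 1.
Proof. by rewrite [1 in LHS]/(quot_one _) piece_value_proj value1. Qed.

Lemma piece_valueV n (x : piece n.+1) : piece_value x^-1 = (piece_value x)^-1.
Proof. by apply/eqP; rewrite eq_sym eq_invg_mul -piece_valueM mulgV piece_value1. Qed.

Lemma piece_finite n : finite_set [set: piece n].
Proof.
case: n => [|n].
  apply: (@sub_finite_set _ _ [set quot_proj (kernel_subgroup 0) 1]) => //.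
  by elim/piece_ind => a _; apply/quot_projP.
have -> : [set: piece n.+1] = @piece_value n @^-1` setT by [].
by apply: finite_preimage => // x y _ _ /piece_value_inj.
Qed.

Lemma marking_finite : finite_set marking.
Proof. exact/finite_image/finite_finset. Qed.

Lemma marking_generates : generates marking.
Proof.
move=> a; exists [seq of_word [:: i] | i <- generic_quotient.repr a].
  by move=> _ /mapP[i _ ->]; left; exists i.
by rewrite big_map -of_word_prod; exact/esym/reprK.
Qed.

Lemma level_kernelS n : {subset level_kernel n.+1 <= level_kernel n}.
Proof. by case: n => [//|n] a; rewrite !inE => /eqP/nested/eqP. Qed.

Lemma level_kernel_cap a : (forall n, a \in level_kernel n) -> a = 1.
Proof.
move=> a1; apply: value_inj => n; rewrite value1; apply/eqP.
by have := a1 n.+1; rewrite inE.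
Qed.

(** The zeroth piece is the trivial group, and the piece of index [n.+1] is
    the subgroup of [H n] generated by the marking. *)
Definition tower_box : box_space word_group :=
  @BoxSpace word_group marking kernel_subgroup
    marking_finite marking_generates (fun=> isT)
    level_kernelS piece_finite level_kernel_cap.

Lemma word_group_finitely_generated : finitely_generated word_group.
Proof. by exists marking; [exact: marking_finite|exact: marking_generates]. Qed.

Lemma word_group_residually_finite : residually_finite word_group.
Proof.
move=> a a1; apply: contrapT => /forall2NP aN; move/eqP: a1; apply.
apply: level_kernel_cap => n; have [/(_ (piece_finite n))//|] := aN (kernel_subgroup n).
by move=> /negP; rewrite negbK.
Qed.

Local Notation piece_gens n :=
  (quot_proj (kernel_subgroup n.+1) @` marking).

Lemma piece_gen_value n (s : piece n.+1) :
  piece_gens n s \/ piece_gens n s^-1 -> exists i, piece_value s = h n i.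
Proof.
have gen t : piece_gens n t -> exists i, piece_value t = h n i.
  by move=> [_ [i _ <-] <-]; exists i; rewrite piece_value_proj value_of_word /eval big_seq1.
case=> /gen[i sE]; exists i => //.
by apply/eqP; rewrite -[piece_value s]invgK -piece_valueV sE eq_invg_mul hK.
Qed.

Lemma eval_piece n (x : piece n.+1) : exists w, piece_value x = eval n w.
Proof.
by elim/piece_ind: x => a; rewrite piece_value_proj; exists (generic_quotient.repr a).
Qed.

Local Notation words_between n x y := [set k | exists w : seq (piece n.+1),
  [/\ word_in (piece_gens n) w, size w = k & x^-1 * y = \prod_(s <- w) s]].

Let word_between n (x y : piece n.+1) w :
  piece_value y = piece_value x * eval n w -> words_between n x y (size w).
Proof.
move=> yE; exists [seq quot_proj (kernel_subgroup n.+1) (of_word [:: i]) | i <- w].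
split; [|by rewrite size_map|].
  by move=> _ /mapP[i _ ->]; left; exists (of_word [:: i]) => //; exists i.
apply: piece_value_inj; rewrite piece_valueM piece_valueV yE mulKg big_map.
rewrite (big_morph _ (@piece_valueM n) (piece_value1 n)).
by apply: eq_bigr => i _; rewrite piece_value_proj value_of_word /eval big_seq1.
Qed.

Lemma piece_word n (x : piece n.+1) w : exists2 y : piece n.+1,
  piece_value y = piece_value x * eval n w & (word_dist (piece_gens n) x y <= size w)%N.
Proof.
exists (x * quot_proj _ (of_word w)).
  by rewrite piece_valueM piece_value_proj value_of_word.
by apply: (leastP _).2; apply: word_between;
  rewrite piece_valueM piece_value_proj value_of_word.
Qed.

Lemma piece_dist_word n (x y : piece n.+1) :
  exists2 w, size w = word_dist (piece_gens n) x y
    & piece_value y = piece_value x * eval n w.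
Proof.
have [w xyw] := eval_piece (x^-1 * y).
rewrite /word_dist; have [|[v [vS <- xyv]] _] := @leastP (words_between n x y) (size w).
  by apply: word_between; rewrite -xyw -piece_valueM mulKVg.
have -> : piece_value y = piece_value x * \prod_(s <- v) piece_value s.
  by rewrite -(big_morph _ (@piece_valueM n) (piece_value1 n)) -xyv -piece_valueM mulKVg.
elim: v vS {xyv} => [|s v IHv] vS; first by exists [::]; rewrite /eval ?big_nil.
have [|u uv /mulgI vu] := IHv; first by move=> t tv; apply: vS; rewrite in_cons tv orbT.
have [i si] := piece_gen_value (vS s (mem_head _ _)).
by exists (i :: u); rewrite /= ?uv // /eval !big_cons si vu.
Qed.

End MarkedTower.

(** * Balls *)

Section Balls.
Variables (I : finType) (H : finGroupType) (h : I -> H).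

Fixpoint ball k : {set H} :=
  if k is j.+1 then
    (ball j :|: [set (xi.1 * h xi.2)%g | xi in finset.setX (ball j) [set: I]])%SET
  else [set 1%g]%SET.

Lemma card_ball k : (#|ball k| <= #|I|.+1 ^ k)%N.
Proof.
elim: k => [|k IHk]; first by rewrite cards1.
apply: (leq_trans (leq_card_setU _ _)); rewrite expnS mulSn.
apply: leq_add => //; apply: (leq_trans (leq_imset_card _ _)).
by rewrite cardsX cardsT mulnC leq_mul2l IHk orbT.
Qed.

Lemma ball_word w k : (size w <= k)%N -> (\prod_(i <- w) h i)%g \in ball k.
Proof.
elim: k w => [|k IHk] w; first by rewrite leqn0 size_eq0 => /eqP->; rewrite big_nil inE.
case/lastP: w => [|w i]; first by rewrite /= inE IHk.
rewrite size_rcons ltnS => wk; rewrite /= inE; apply/orP; right.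
rewrite -cats1 big_cat big_seq1.
by apply/imsetP; exists ((\prod_(j <- w) h j)%g, i) => //=; rewrite !inE IHk.
Qed.

Lemma word_ball g k : g \in ball k -> exists2 w, (size w <= k)%N & g = (\prod_(i <- w) h i)%g.
Proof.
elim: k g => [|k IHk] g /=; first by rewrite inE => /eqP->; exists [::]; rewrite ?big_nil.
rewrite inE => /orP[/IHk[w wk ->]|]; first by exists w; rewrite ?leqW.
move=> /imsetP[[x i]]; rewrite !inE /= andbT => /IHk[w wk ->] ->.
by exists (rcons w i); rewrite ?size_rcons // -cats1 big_cat big_seq1.
Qed.

End Balls.

(** * The box space and maps into metric spaces *)

Definition box : box_space (word_group level_gen) :=
  tower_box level_genK level_nested.

Local Notation piece n := (box_piece box n.+1).
Local Notation pval := (@piece_value _ _ level_gen level_genK _).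

Definition generated n : {set level n} :=
  [set x | `[< exists w, x = eval level_gen n w >]]%SET.

Lemma generatedP n (x : level n) :
  reflect (exists w, x = eval level_gen n w) (x \in generated n).
Proof. by rewrite inE; exact: asboolP. Qed.

Lemma generated_gen n (x : level n) i :
  (x * level_gen n i)%g \in generated n = (x \in generated n).
Proof.
have imp (y : level n) : y \in generated n -> (y * level_gen n i)%g \in generated n.
  move=> /generatedP[w ->]; apply/generatedP; exists (w ++ [:: i]).
  by rewrite eval_cat /eval big_seq1.
by apply/idP/idP => /imp //; rewrite -mulgA level_genK mulg1.
Qed.

Lemma generated_piece n (x : level n) : x \in generated n -> {y : piece n | pval y = x}.
Proof.
move=> /generatedP xw; apply: cid; have [w ->] := xw.
exists (quot_proj _ (of_word level_gen w)).
by rewrite piece_value_proj value_of_word.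
Qed.

Lemma piece_generated n (y : piece n) : pval y \in generated n.
Proof. by apply/generatedP; exact: eval_piece. Qed.

Section NonEmbedding.
Variables (R : realType) (M : Type) (dM : M -> M -> R) (m0 : M) (p : R).
Hypothesis p0 : 0 < p.
Hypothesis dM0 : dM m0 m0 = 0.
(** The maps are defined on the whole level, with a default value outside the
    generated subgroup, which plays the part of [B]. *)
Hypothesis poincare : forall L : R, exists C : R,
  forall n (B : {set level n}) (psi : level n -> M),
  (forall x i, ((x * level_gen n i)%g \in B) = (x \in B)) ->
  (forall x, x \notin B -> psi x = m0) ->
  (forall x i, dM (psi (x * level_gen n i)%g) (psi x) <= L) ->
  \sum_x \sum_a dM (psi (x * level_trans a)%g) (psi x) `^ p <=
    C * #|{: plane n}|%:R * #|B|%:R.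

(** A coarse embedding sends only the boundedly many translations of a ball to
    small distances, so the mean over all translations is large. *)
Lemma not_coarsely_embeds : ~ coarsely_embeds (@box_dist R _ box) dM.
Proof.
case=> phi [rho [gamma [[rho0 rhoP] [gamma0 gammaP] phiP]]].
have phi_lower m x y : rho (box_dist R x y) <= dM (phi m x) (phi m y).
  by case/andP: (phiP m x y).
have phi_upper m x y : dM (phi m x) (phi m y) <= gamma (box_dist R x y).
  by case/andP: (phiP m x y).
pose L := Num.max (gamma 0) (gamma 1).
have [C hC] := poincare L.
(* Half of the translations at distance [T] already exceed the bound [C]. *)
pose T := (2 * `|C| + 1) `^ p^-1.
have TE : T `^ p = 2 * `|C| + 1.
  by rewrite /T -powRrM mulVf ?gt_eqF // powRr1 // addr_ge0 // mulr_ge0.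
have T0 : 0 < T by rewrite powR_gt0 // ltr_wpDl // mulr_ge0.
have [k hk] : exists k : nat, forall s, 0 <= s -> rho s <= T -> s <= k%:R.
  have [] := rhoP [set s | 0 <= s <= T].
    exists T; split; first by rewrite num_real.
    by move=> e Te s /= /andP[s0 sT]; rewrite ger0_norm // (le_trans sT) // ltW.
  move=> e [_ he]; exists (Num.truncn (e + 1)).+1 => s s0 sT.
  rewrite (le_trans _ (ltW (truncnS_gt _))) //.
  apply: (@le_trans _ _ `|s|); first exact: ler_norm.
  by apply: he; rewrite ?ltrDl //=; split=> //; rewrite rho0.
pose b := (#|{: generator}|.+1 ^ k)%N.
have [n nb] : exists n, (2 * b < #|{: plane n}|)%N.
  exists (2 * b)%N; rewrite card_plane; apply: (leq_trans (ltn_expl _ (isT : 1 < 2)%N)).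
  by rewrite leq_pmulr // expn_gt0.
pose psi (x : level n) : M :=
  if boolP (x \in generated n) is AltTrue xG then phi n.+1 (projT1 (generated_piece xG))
  else m0.
have psi_piece y : psi (pval y) = phi n.+1 y.
  rewrite /psi; case: {-}_ / boolP => [xG|]; last by rewrite piece_generated.
  by case: generated_piece => z /= /piece_value_inj ->.
have psi_off x : x \notin generated n -> psi x = m0.
  by move=> xG; rewrite /psi; case: {-}_ / boolP => // xG'; rewrite xG' in xG.
have psiL x i : dM (psi (x * level_gen n i)%g) (psi x) <= L.
  have [xG|xG] := boolP (x \in generated n); last first.
    rewrite !psi_off ?generated_gen // dM0 le_max; apply/orP; left; exact: gamma0.
  have xgG : (x * level_gen n i)%g \in generated n by rewrite generated_gen.
  have [z zx] := generated_piece xgG.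
  have [y] := piece_word z [:: i].
  rewrite /eval big_seq1 zx -mulgA level_genK mulg1 => yx zy.
  rewrite -zx -yx !psi_piece; apply: le_trans (phi_upper _ _ _) _.
  rewrite /box_dist le_max; move: zy; rewrite -/(box_gen box).
  by case: (word_dist _ z y) => [|[|//]] _; rewrite lexx ?orbT.
have near_card x : x \in generated n ->
    (#|[set a | (dM (psi (x * level_trans a)%g) (psi x) <= T)%R]%SET| <= b)%N.
  move=> xG; apply: leq_trans (card_ball (level_gen n) k).
  rewrite -(card_imset _ (@level_trans_inj n)); apply/subset_leq_card/fintype.subsetP => g.
  move=> /imsetP[a]; rewrite inE => aT ->.
  have xaG : (x * level_trans a)%g \in generated n.
    have [w ->] := trans_word a; have /generatedP[v ->] := xG.
    by apply/generatedP; exists (v ++ w); rewrite eval_cat.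
  have [y yx] := generated_piece xG; have [z zx] := generated_piece xaG.
  have [w wE yz] := piece_dist_word z y.
  have -> : level_trans a = eval level_gen n (rev w).
    rewrite (eval_rev level_genK); apply: (mulIg (eval level_gen n w)).
    by apply: (mulgI x); rewrite mulVg mulg1 mulgA -zx -yz.
  apply: ball_word; rewrite size_rev wE -(ler_nat R); apply: hk => //.
  rewrite -[X in rho X]/(@box_dist R _ box n.+1 z y).
  by apply: le_trans (phi_lower _ _ _) _; rewrite -!psi_piece zx yx.
have := hC n (generated n) psi (@generated_gen n) psi_off psiL.
rewrite leNgt => /negP; apply.
set N : R := #|{: plane n}|%:R.
have N0 : 0 < N by rewrite ltr0n; apply: leq_ltn_trans nb.
have G0 : 0 < #|generated n|%:R :> R.
  rewrite ltr0n; apply/card_gt0P; exists 1%g; apply/generatedP; exists [::].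
  by rewrite /eval big_nil.
have far x : x \in generated n ->
    (N / 2) * T `^ p <= \sum_a dM (psi (x * level_trans a)%g) (psi x) `^ p.
  move=> xG; set F := [set a | (dM (psi (x * level_trans a)%g) (psi x) <= T)%R]%SET.
  apply: (@le_trans _ _ (\sum_(a in (~: F)%SET) T `^ p)).
    rewrite sumr_const -[T `^ p *+ _]mulr_natl ler_wpM2r ?powR_ge0 //.
    have : #|F|%:R + #|(~: F)%SET|%:R = N by rewrite -natrD finset.cardsC.
    have : #|F|%:R <= b%:R :> R by rewrite ler_nat near_card.
    have : (2 * b)%:R <= N by rewrite ler_nat ltnW.
    rewrite natrM; lra.
  rewrite [leRHS](bigID (mem (~: F)%SET)) /= -[leLHS]addr0 lerD //.
    apply: ler_sum => a; rewrite !inE -ltNge => Ta.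
    apply: ge0_ler_powR; rewrite ?nnegrE ?(ltW p0) ?(ltW T0) ?(ltW Ta) //.
    exact: ltW (lt_trans T0 Ta).
  by apply: sumr_ge0 => a _; exact: powR_ge0.
apply: (@lt_le_trans _ _ (\sum_(x in generated n) (N / 2) * T `^ p)).
  rewrite sumr_const -[N / 2 * _ *+ _]mulr_natr ltr_pM2r // TE.
  have := ler_norm C; nra.
rewrite [leRHS](bigID (mem (generated n))) /= -[leLHS]addr0 lerD //.
  by apply: ler_sum => x; exact: far.
by apply: sumr_ge0 => x _; apply: sumr_ge0 => a _; exact: powR_ge0.
Qed.

End NonEmbedding.

(** * Lebesgue spaces *)

Section LpSpaces.
Context (R : realType) (p : R) (p1 : (1 <= p%:E)%E) (d : measure_display)
  (Om : measurableType d) (mu : {measure set Om -> \bar R}).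
Local Notation Lp := (LspaceType mu p1).
Local Notation dist := (@Lp_dist R d Om mu p%:E p1).

Let rp1 : 1 <= p. Proof. by move: p1; rewrite lee_fin. Qed.
Let p0 : 0 < p. Proof. exact: lt_le_trans rp1. Qed.

Lemma Lspace_measurable (f : Lp) : measurable_fun setT (f : Om -> R).
Proof. exact: (measurable_funPT (generic_quotient.repr (LebesgueSpace.sort f))). Qed.

Lemma Lspace_Lfun (f : Lp) : (f : Om -> R) \in Lfun mu p%:E.
Proof.
rewrite inE; apply/andP; split; rewrite inE /=; last exact: Lebesgue_finite.
exact: Lspace_measurable.
Qed.

Lemma Lp_dist_powR (f g : Lp) :
  ((dist f g `^ p)%:E = \int[mu]_t (`|(f : Om -> R) t - (g : Om -> R) t| `^ p)%:E)%E.
Proof.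
have fg : ((f : Om -> R) - (g : Om -> R)) \in Lfun mu p%:E.
  by apply: rpredB; exact: Lspace_Lfun.
have fin : ('N[mu]_p%:E[(fun t => ((f : Om -> R) t - (g : Om -> R) t)%:E)] < +oo)%E.
  by case/andP: fg => _; rewrite inE.
rewrite -poweR_EFin /Lp_dist fineK; last by rewrite ge0_fin_numE ?Lnorm_ge0.
by rewrite powR_Lnorm ?gt_eqF.
Qed.

Lemma Lp_dist_ge0 (f g : Lp) : 0 <= dist f g.
Proof. by rewrite fine_ge0 ?Lnorm_ge0. Qed.

Lemma Lp_dist_xx (f : Lp) : dist f f = 0.
Proof.
rewrite /Lp_dist (@eq_Lnorm _ _ _ _ _ _ (cst 0%E)) => [|t]; last by rewrite /= subrr.
by rewrite Lnorm0 // eqe gt_eqF.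
Qed.

(** The scalar inequality, whose sums are finite, is integrated over [Om]. *)
Lemma Lp_dist_gap : exists2 C : R, 0 <= C & forall n (psi : level n -> Lp),
  \sum_x \sum_a dist (psi (x * level_trans a)%g) (psi x) `^ p <=
  C * #|{: plane n}|%:R * \sum_i \sum_x dist (psi (x * level_gen n i)%g) (psi x) `^ p.
Proof.
have [C C0 gap] := gap_Lp rp1; exists C => // n psi.
pose E (f g : Lp) : Om -> \bar R := fun t => (`|(f : Om -> R) t - (g : Om -> R) t| `^ p)%:E.
have mE f g : measurable_fun [set: Om] (E f g : Om -> \bar R).
  apply/measurable_EFinP; apply: (measurableT_comp (measurable_powR _)).
  by apply: measurableT_comp => //; apply: measurable_funB; exact: Lspace_measurable.
have E0 f g t : setT t -> (0 <= E f g t)%E by move=> _; rewrite lee_fin powR_ge0.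
have CN0 : 0 <= C * #|{: plane n}|%:R by rewrite mulr_ge0.
have lhsE : (\sum_x \sum_a dist (psi (x * level_trans a)%g) (psi x) `^ p)%:E =
    (\int[mu]_t \sum_x \sum_a E (psi (x * level_trans a)%g) (psi x) t)%E.
  rewrite ge0_integral_sum //; last 2 first.
  - move=> x; apply: emeasurable_sum => ?; exact: mE.
  - move=> x t _; apply: sume_ge0 => ? _; exact: E0.
  rewrite -sumEFin; apply: eq_bigr => x _; rewrite ge0_integral_sum //;
    last by move=> *; exact: E0.
  rewrite -sumEFin.
  by apply: eq_bigr => a _; exact: Lp_dist_powR.
have rhsE : (\sum_i \sum_x dist (psi (x * level_gen n i)%g) (psi x) `^ p)%:E =
    (\int[mu]_t \sum_i \sum_x E (psi (x * level_gen n i)%g) (psi x) t)%E.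
  rewrite ge0_integral_sum //; last 2 first.
  - move=> i; apply: emeasurable_sum => ?; exact: mE.
  - move=> i t _; apply: sume_ge0 => ? _; exact: E0.
  rewrite -sumEFin; apply: eq_bigr => i _; rewrite ge0_integral_sum //;
    last by move=> *; exact: E0.
  rewrite -sumEFin.
  by apply: eq_bigr => x _; exact: Lp_dist_powR.
rewrite -lee_fin EFinM lhsE rhsE -ge0_integralZl_EFin //; last 2 first.
- move=> t _; apply: sume_ge0 => i _; apply: sume_ge0 => ? _; exact: E0.
- apply: emeasurable_sum => i; apply: emeasurable_sum => ?; exact: mE.
apply: ge0_le_integral => //.
- move=> t _; apply: sume_ge0 => x _; apply: sume_ge0 => ? _; exact: E0.
- apply: emeasurable_sum => x; apply: emeasurable_sum => ?; exact: mE.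
- apply: measurable_funeM; apply: emeasurable_sum => i; apply: emeasurable_sum => ?; exact: mE.
move=> t _; rewrite /E.
under eq_bigr do rewrite sumEFin.
under [X in (_ <= _ * X)%E]eq_bigr do rewrite sumEFin.
rewrite !sumEFin -EFinM lee_fin.
exact: (gap n (fun x => (psi x : Om -> R) t)).
Qed.

End LpSpaces.

Theorem box_not_in_Lp (R : realType) (p : R) (p1 : (1 <= p%:E)%E) (d : measure_display)
    (Om : measurableType d) (mu : {measure set Om -> \bar R}) :
  ~ coarsely_embeds (@box_dist R _ box) (@Lp_dist R d Om mu p%:E p1).
Proof.
have rp1 : 1 <= p by move: p1; rewrite lee_fin.
have p0 : 0 < p := lt_le_trans ltr01 rp1.
move=> emb; have [phi _] := emb; pose m0 := phi 0%N (quot_proj _ 1%g).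
have [C C0 gap] := Lp_dist_gap p1 mu.
apply: (@not_coarsely_embeds R _ _ m0 p p0 (Lp_dist_xx m0)) emb => L.
exists (C * (5%:R * `|L| `^ p)) => n B psi Bgen psi0 psiL.
apply: le_trans (gap n psi) _.
have -> : C * (5%:R * `|L| `^ p) * #|{: plane n}|%:R * #|B|%:R =
  C * #|{: plane n}|%:R * (5%:R * (#|B|%:R * `|L| `^ p)) by ring.
rewrite ler_wpM2l ?mulr_ge0 //.
have -> : 5%:R * (#|B|%:R * `|L| `^ p) = \sum_(i : generator) #|B|%:R * `|L| `^ p.
  by rewrite sumr_const card_generator mulr_natl.
apply: ler_sum => i _; rewrite mulr_natl -sumr_const.
rewrite [leLHS](bigID (mem B)) /= [X in _ + X]big1 ?addr0 => [|x xB].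
  apply: ler_sum => x _; apply: ge0_ler_powR; rewrite ?nnegrE ?(ltW p0) ?Lp_dist_ge0 //.
  exact: le_trans (psiL x i) (ler_norm _).
by rewrite !psi0 ?Bgen // Lp_dist_xx powR0 // gt_eqF.
Qed.

(** * Finite measure spaces *)

(** The point serves only to make the type pointed. *)
Definition discrete (T : finType) (x0 : T) : Type := T.

Section FiniteMeasure.
Variables (R : realType) (T : finType) (x0 : T).
Local Notation discrete := (discrete x0).

HB.instance Definition _ := Finite.on discrete.
HB.instance Definition _ := isPointed.Build discrete x0.
HB.instance Definition _ := isMeasurable.Build default_measure_display discrete
  (@discrete_measurable0 T) (@discrete_measurableC T) (@discrete_measurableU T).

Let points := msum (fun k =>
  dirac (nth x0 (enum T) k : discrete) : {measure set discrete -> \bar R}) #|T|.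
Definition count_points : {measure set discrete -> \bar R} := points.

Lemma discrete_measurable_fun d (U : measurableType d) (f : discrete -> U) :
  measurable_fun setT f.
Proof. by []. Qed.

Lemma sum_nth_enum (F : T -> \bar R) :
  (\sum_(k < #|T|) F (nth x0 (enum T) k) = \sum_x F x)%E.
Proof. by rewrite -[RHS]big_enum /= (big_nth x0) -cardE big_mkord. Qed.

Lemma integral_count_points (f : discrete -> \bar R) : (forall x, (0 <= f x)%E) ->
  (\int[count_points]_x f x = \sum_(x : T) f x)%E.
Proof.
move=> f0.
rewrite ge0_integral_measure_sum; [|exact: measurableT|by move=> x _; exact: f0|by []].
rewrite -sum_nth_enum; apply: eq_bigr => k _.
by rewrite integral_dirac ?diracT ?mul1e //; exact: measurableT.
Qed.

Lemma count_points_ge1 (B : set discrete) x : B x -> (1 <= count_points B)%E.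
Proof.
move=> Bx; rewrite /count_points /= /msum (sum_nth_enum (fun y => \d_(y : discrete) B)).
rewrite (bigD1 (x : T)) //= diracE mem_set //= leeDl // sume_ge0 //.
Qed.

Lemma count_points_ae (P : discrete -> Prop) :
  {ae count_points, forall x, P x} -> forall x, P x.
Proof.
move=> [B [_ B0 PB]] x; apply: contrapT => Px.
by have := count_points_ge1 (PB x Px); rewrite B0 lee_fin ler10.
Qed.

Lemma count_points_gt0 : (0 < count_points setT)%E.
Proof. by apply: lt_le_trans (@count_points_ge1 setT x0 I); rewrite lte01. Qed.

Lemma Lnorm2_count_points (f : discrete -> R) :
  ('N[count_points]_2[EFin \o f] = (Num.sqrt (\sum_(x : T) f x ^+ 2))%:E)%E.
Proof.
rewrite unlock /Lnorm integral_count_points /= => [|x]; last by rewrite lee_fin powR_ge0.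
rewrite sumEFin poweR_EFin powR12_sqrt; last by apply: sumr_ge0 => x _; exact: powR_ge0.
congr (Num.sqrt _)%:E; apply: eq_bigr => x _.
by rewrite powR_mulrn // -normrX ger0_norm // sqr_ge0.
Qed.

Lemma Lnorm1_count_points (f : discrete -> R) :
  ('N[count_points]_1[EFin \o f] = (\sum_(x : T) `|f x|)%:E)%E.
Proof. by rewrite Lnorm1 integral_count_points /= ?sumEFin // => x; rewrite lee_fin. Qed.

Lemma LnormT_count_points_ge (f : discrete -> R) x :
  (`|f x|%:E <= 'N[count_points]_+oo[EFin \o f])%E.
Proof.
rewrite unlock /Lnorm count_points_gt0.
exact: (count_points_ae (ess_sup_ge count_points (abse \o (EFin \o f)))).
Qed.

Lemma LnormT_count_points_le (f : discrete -> R) b :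
  (forall x, (`|f x|%:E <= b)%E) -> ('N[count_points]_+oo[EFin \o f] <= b)%E.
Proof.
move=> fb; rewrite unlock /Lnorm count_points_gt0.
by apply/ess_supP/nearW => x /=.
Qed.

Lemma count_points_Lfun (f : discrete -> R) : f \in Lfun count_points 2%:E.
Proof.
rewrite inE; apply/andP; split; rewrite inE /=; first exact: discrete_measurable_fun.
by rewrite /finite_norm Lnorm2_count_points ltry.
Qed.

End FiniteMeasure.

(** * Uniformly curved Banach spaces *)

Section Curved.
Variables (R : realType) (X : completeNormedModType R).

Section Level.
Variable n : nat.
Local Notation Om := (discrete (1%g : level n)).
Local Notation mu := (count_points R (1%g : level n)).
Local Notation L2 := (LfunType mu (lee1n 2)).

Definition count_Lfun (f : Om -> R) : L2 := Lfun_Sub (lee1n 2) (count_points_Lfun f).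

Lemma count_LfunE f : count_Lfun f = f :> (Om -> R).
Proof. exact: Lfun_valP. Qed.

Definition smoothing_op k (f : L2) : L2 :=
  count_Lfun (@smoothing R n R^o k (f : Om -> R)).

Lemma smoothing_op_linear k : ae_linear (smoothing_op k).
Proof.
move=> a f g; apply: aeW => t; rewrite !count_LfunE.
exact: (congr1 (fun h => h t) (@smoothing_linear R n R^o k a f g)).
Qed.

Lemma smoothing_op_L2 k e : 0 < e -> (1439 / 1440) ^+ k <= e ^+ 2 ->
  Lp_bounded 2%E e (smoothing_op k).
Proof.
move=> e0 ke f; rewrite !Lnorm2_count_points -EFinM lee_fin.
rewrite -[X in X * _](ger0_norm (ltW e0)) -sqrtr_sqr -sqrtrM ?sqr_ge0 // ler_wsqrtr //.
apply: (le_trans (sum_sqr_smoothing k _)).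
by apply: ler_wpM2r => //; apply: sumr_ge0 => x _; exact: sqr_ge0.
Qed.

Lemma smoothing_op_L1 k : Lp_bounded 1%E 1 (smoothing_op k).
Proof.
move=> f; rewrite !Lnorm1_count_points mul1e lee_fin.
exact: (sum_norm_smoothing k (f : level n -> R^o)).
Qed.

Lemma smoothing_op_sup k : Lp_bounded +oo%E 1 (smoothing_op k).
Proof.
move=> f; rewrite mul1e; apply: LnormT_count_points_le => x.
have fin y : (`|(f : Om -> R) y|%:E <= 'N[mu]_+oo[EFin \o f])%E.
  exact: LnormT_count_points_ge.
case: ('N[mu]_+oo[EFin \o f])%E fin => [b fb||fb]; last 2 first.
- by move=> _; rewrite leey.
- by have := fb x; rewrite leeNy_eq.
rewrite lee_fin count_LfunE.
by apply: (@norm_smoothing_le R n R^o k) => y; have := fb y; rewrite lee_fin.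
Qed.

Lemma point_decomposition (F : level n -> X) :
  F = fun x => \sum_y (x == y)%:R *: F y.
Proof.
apply: boolp.funext => x; rewrite (bigD1 x)//= eqxx scale1r big1 ?addr0 // => y yx.
by rewrite eq_sym (negPf yx) scale0r.
Qed.

Lemma bochner_count (F : level n -> X) : bochner_L2 mu (F : Om -> X).
Proof.
split; last by rewrite /bochner_norm2 Lnorm2_count_points ltry.
exists (fun=> F); split => //; last by move=> t; exact: cvg_cst.
by move=> _; apply: finite_image; exact: finite_finset.
Qed.

(** A bounded extension of the smoothing operator to vector-valued functions
    is the smoothing of vector-valued functions, because both are linear and
    agree on elementary tensors, which span. *)
Lemma bochner_smoothing k c : 0 <= c -> bochner_bounded X c (smoothing_op k) ->
  forall F : level n -> X, \sum_x `|smoothing k F x| ^+ 2 <= c ^+ 2 * \sum_x `|F x| ^+ 2.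
Proof.
move=> c0 [TX [TX2 TXlin TXtensor TXbound]] F.
have lin a G H t : TX (fun x => a *: G x + H x) t = a *: TX G t + TX H t.
  by move: t; apply: count_points_ae; apply: TXlin; exact: bochner_count.
have tensor (f : level n -> R) v t :
    TX (fun x => f x *: v) t = smoothing k (fun x => f x *: v) t.
  rewrite smoothing_tensor; move: t; apply: count_points_ae.
  exact: (TXtensor (count_Lfun f) v).
have TXE : TX F = smoothing k F.
  apply: boolp.funext => t; rewrite (point_decomposition F).
  elim: (index_enum (level n)) => [|y s IHs].
    have zero : (fun x : level n => \sum_(y <- [::]) (x == y)%:R *: F y) =
        fun x => 0 *: (0 : X).
      by apply: boolp.funext => x; rewrite big_nil scale0r.
    by rewrite zero; exact: (tensor (fun=> 0) 0 t).
  have step : (fun x : level n => \sum_(z <- y :: s) (x == z)%:R *: F z) =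
      fun x => 1 *: ((x == y)%:R *: F y) + \sum_(z <- s) (x == z)%:R *: F z.
    by apply: boolp.funext => x; rewrite big_cons scale1r.
  rewrite step lin IHs smoothing_linear; congr (_ *: _ + _).
  exact: (tensor (fun x => (x == y)%:R)).
have := TXbound F (bochner_count F); rewrite TXE /bochner_norm2 !Lnorm2_count_points.
rewrite -EFinM lee_fin => bound.
have S0 (G : level n -> X) : 0 <= \sum_x `|G x| ^+ 2.
  by apply: sumr_ge0 => x _; exact: sqr_ge0.
rewrite -[leLHS]sqr_sqrtr // -[X in _ * X]sqr_sqrtr // -exprMn.
by rewrite ler_sqr ?nnegrE ?mulr_ge0 ?sqrtr_ge0.
Qed.

End Level.

(** The scalar norm of the operator on L2 decreases geometrically in [k], at a
    rate that does not depend on the level. *)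
Lemma curved_smoothing : uniformly_curved X -> exists k, forall n (F : level n -> X),
  \sum_x `|smoothing k F x| ^+ 2 <= 4^-1 ^+ 2 * \sum_x `|F x| ^+ 2.
Proof.
move=> [Delta Delta0 curved].
have [e [e0 De]] : exists e : R, 0 < e /\ Delta e <= 4^-1.
  have : \forall e \near (0 : R)^'+, 0 < e /\ Delta e <= 4^-1.
    near=> e; split; first by near: e; exact: nbhs_right_gt.
    apply: le_trans (ler_norm _) _; rewrite -normrN -sub0r; near: e.
    by apply: (@cvgrPdist_le _ _ _ _ _ _ _).1 => //; rewrite invr_gt0.
  by move=> /filter_ex.
have [k ke] : exists k, (1439 / 1440) ^+ k <= e ^+ 2.
  have [c c01 ->] : exists2 c : R, `|c| < 1 & 1439 / 1440 = c.
    by exists (1439 / 1440); [rewrite ger0_norm; lra|reflexivity].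
  have : \forall k \near \oo, c ^+ k <= e ^+ 2.
    near=> k; apply: le_trans (ler_norm _) _; rewrite -normrN -sub0r; near: k.
    by apply: (@cvgrPdist_le _ _ _ _ _ _ _).1; [exact: cvg_expr|rewrite exprn_gt0].
  by move=> /filter_ex.
exists k => n F; apply: bochner_smoothing => //.
have [TX [TX2 TXlin TXtensor TXbound]] := curved e e0 _ _ _ _ (@smoothing_op_linear n k)
  (@smoothing_op_L2 n k e e0 ke) (@smoothing_op_L1 n k) (@smoothing_op_sup n k).
exists TX; split=> // G GL; apply: le_trans (TXbound G GL) _.
by apply: lee_wpmul2r; rewrite ?Lnorm_ge0 // lee_fin.
Unshelve. all: end_near. Qed.

End Curved.

(** The centred map is close to its smoothing because the map is Lipschitz, and
    the smoothing is small compared with the centred map, which is therefore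
    bounded in square mean. *)
Theorem box_not_in_curved (R : realType) (X : completeNormedModType R) :
  uniformly_curved X -> ~ coarsely_embeds (@box_dist R _ box) (@norm_dist R X).
Proof.
move=> /curved_smoothing[k small].
apply: (@not_coarsely_embeds R X (@norm_dist R X) 0 2) => //.
  by rewrite /norm_dist subrr normr0.
move=> L; exists (64 * (k%:R * L) ^+ 2) => n B F Bgen F0 FL.
have N0 : 0 < #|{: plane n}|%:R :> R by rewrite ltr0n card_plane_gt0.
have Btrans x a : ((x * level_trans a)%g \in B) = (x \in B).
  have [w ->] := trans_word a; elim/last_ind: w => [|w i IHw]; first by rewrite big_nil mulg1.
  by rewrite -cats1 big_cat big_seq1 /= mulgA Bgen.
pose u := centered F.
have off (G : level n -> X) : (forall x, x \notin B -> G x = 0) ->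
    forall x, x \notin B -> avg G x = 0.
  by move=> G0 x xB; rewrite /avg G0 // add0r big1 ?scaler0 // => i _; rewrite G0 // Bgen.
have u_off x : x \notin B -> u x = 0.
  move=> xB; rewrite /u /centered F0 // sub0r /mean big1 ?scaler0 ?oppr0 // => a _.
  by rewrite F0 // Btrans.
have s_off x : x \notin B -> smooth k u x = 0.
  by elim: k {small} x => [|j IHj] /=; [exact: u_off|exact: off].
have sum_on (G : level n -> R) : (forall x, x \notin B -> G x = 0) ->
    \sum_x G x = \sum_(x in B) G x.
  by move=> G0; rewrite [RHS]big_mkcond; apply: eq_bigr => x _; case: ifPn => // /G0.
have uu : centered u = u.
  by apply: boolp.funext => x; rewrite {1}/centered /mean centered_sum scaler0 subr0.
set S := \sum_x `|u x| ^+ 2.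
have smallS : \sum_x `|smooth k u x| ^+ 2 <= 4^-1 * S.
  have := small n u; rewrite /smoothing uu.
  under eq_bigr do rewrite normrZ exprMn ger0_norm ?invr_ge0 //.
  by rewrite -mulr_sumr -/S; lra.
have near_u x : `|u x - smooth k u x| <= k%:R * (2 * L).
  by apply: norm_smooth_dist => y i; exact: FL.
have SB : S <= 16 * (k%:R * L) ^+ 2 * #|B|%:R.
  have : S <= \sum_(x in B) (2 * (k%:R * (2 * L)) ^+ 2 + 2 * `|smooth k u x| ^+ 2).
    rewrite /S sum_on => [|x /u_off->]; last by rewrite normr0 expr0n.
    apply: ler_sum => x _; have := ler_normD (u x - smooth k u x) (smooth k u x).
    rewrite subrK; have := near_u x; have := normr_ge0 (u x); have := normr_ge0 (smooth k u x).
    have := normr_ge0 (u x - smooth k u x).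
    move: `|u x - _| `|u x| `|smooth k u x| (k%:R * (2 * L)) => p q r s.
    move=> p0 r0 q0 ps qpr; have : q ^+ 2 <= (p + r) ^+ 2 by rewrite ler_sqr ?nnegrE ?addr_ge0.
    have : p ^+ 2 <= s ^+ 2 by rewrite ler_sqr ?nnegrE // (le_trans p0).
    have := sqr_ge0 (p - r); nra.
  have -> : \sum_(x in B) (2 * (k%:R * (2 * L)) ^+ 2 + 2 * `|smooth k u x| ^+ 2) =
      8 * (k%:R * L) ^+ 2 * #|B|%:R + 2 * \sum_x `|smooth k u x| ^+ 2.
    rewrite big_split -mulr_sumr /= sumr_const -[_ *+ #|B|]mulr_natr.
    have -> : \sum_x `|smooth k u x| ^+ 2 = \sum_(x in B) `|smooth k u x| ^+ 2.
      by apply: sum_on => x /s_off->; rewrite normr0 expr0n.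
    by rewrite -mulr_sumr; congr (_ + _); ring.
  move: smallS; rewrite -!mulrA; move: ((k%:R * L) ^+ 2 * #|B|%:R) => l; lra.
have pow2 (y z : X) : norm_dist y z `^ 2 = `|y - z| ^+ 2.
  by rewrite powR_mulrn // /norm_dist.
have sum_trans (G : level n -> R) a : \sum_x G (x * level_trans a)%g = \sum_x G x.
  by rewrite [RHS](reindex_inj (mulIg (level_trans a))).
apply: (@le_trans _ _ (\sum_x \sum_a (2 * `|u (x * level_trans a)%g| ^+ 2 + 2 * `|u x| ^+ 2))).
  apply: ler_sum => x _; apply: ler_sum => a _; rewrite pow2.
  have -> : F (x * level_trans a)%g - F x = u (x * level_trans a)%g - u x.
    by rewrite /u /centered mean_trans opprB addrA subrK.
  have := ler_normB (u (x * level_trans a)%g) (u x).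
  have := normr_ge0 (u (x * level_trans a)%g - u x).
  move: `|_ - _| `|u (_ * _)%g| `|u x| => p q r p0 pqr.
  have : p ^+ 2 <= (q + r) ^+ 2 by rewrite ler_sqr ?nnegrE // (le_trans p0).
  have := sqr_ge0 (q - r); nra.
have -> : \sum_x \sum_a (2 * `|u (x * level_trans a)%g| ^+ 2 + 2 * `|u x| ^+ 2) =
    4 * S * #|{: plane n}|%:R.
  rewrite exchange_big /= (eq_bigr (fun=> 4 * S)) => [|a _].
    by rewrite sumr_const mulr_natr.
  rewrite big_split -!mulr_sumr /= (sum_trans (fun x => `|u x| ^+ 2)) -/S; ring.
rewrite -[leRHS]mulrA [_ * #|B|%:R]mulrC mulrA ler_pM2r //.
by rewrite -mulrA; move: SB; rewrite -!mulrA; move: ((k%:R * L) ^+ 2 * #|B|%:R) => b; lra.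
Qed.

(** * Expanders mapped into a level *)

Section ExpanderIntoLevel.
Variables (R : realType) (K D : nat) (c : R).
Hypothesis c0 : 0 < c.

Definition coarse_map n (X : graph) (phi : X -> level n) : Prop :=
  [/\ (0 < #|X|)%N, forall x : X, (#|[set y | adj x y]%SET| <= D)%N,
      (c%:E <= cheeger R X)%E, forall x, exists w, phi x = eval level_gen n w
    & forall x y, adj x y ->
      exists2 w, (size w <= K)%N & phi y = (phi x * eval level_gen n w)%g].

(** The walls cut the graph, so that expansion bounds the mean wall distance
    of two vertices by the mean wall distance of two neighbours. *)
Lemma sum_wall_dist n (X : graph) (phi : X -> level n) : coarse_map phi ->
  c * (\sum_x \sum_y wall_dist (phi x) (phi y))%:R <= (4 * K * D)%:R * #|X|%:R ^+ 2.
Proof.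
move=> [X0 XD cX words step].
pose B e : {set X} := [set x | (phi x).2.1 e]%SET.
have sumB e : (\sum_x \sum_y ((phi x).2.1 e != (phi y).2.1 e) =
    2 * (#|B e| * #|(~: B e)%SET|))%N.
  have cardB (A : {set X}) : #|A| = (\sum_x (x \in A))%N by rewrite -sum1_card big_mkcond.
  rewrite mul2n -addnn !cardB !big_distrlr /= [X in (_ + X)%N]exchange_big -big_split /=.
  apply: eq_bigr => x _; rewrite -big_split; apply: eq_bigr => y _ /=.
  by rewrite !inE; case: ((phi x).2.1 e); case: ((phi y).2.1 e).
have S1 : (\sum_x \sum_y wall_dist (phi x) (phi y) = 2 * \sum_e #|B e| * #|(~: B e)%SET|)%N.
  rewrite big_distrr /= -(eq_bigr _ (fun e _ => sumB e)) [RHS]exchange_big /=.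
  apply: eq_bigr => x _; rewrite exchange_big /=; apply: eq_bigr => y _.
  rewrite /wall_dist -sum1_card big_mkcond; apply: eq_bigr => e _.
  by rewrite inE; case: (_ != _).
have S2 : (\sum_e #|edge_boundary (B e)| <= #|X| * (D * (2 * K)))%N.
  apply: (@leq_trans (\sum_x \sum_(y | adj x y) wall_dist (phi x) (phi y))).
    rewrite pair_big_dep /=; apply: (@leq_trans (\sum_e \sum_(u : X * X | adj u.1 u.2)
        ((phi u.1).2.1 e != (phi u.2).2.1 e))).
      apply: leq_sum => e _; rewrite -sum1_card big_mkcond [leqRHS]big_mkcond.
      apply: leq_sum => -[x y] _; rewrite !inE /=.
      by case: (adj x y); rewrite ?andbF //; case: ((phi x).2.1 e); case: ((phi y).2.1 e).
    rewrite exchange_big; apply: leq_sum => u _; rewrite /wall_dist -sum1_card.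
    by rewrite [leqRHS]big_mkcond; apply: leq_sum => e _; rewrite inE; case: (_ != _).
  rewrite -sum_nat_const; apply: leq_sum => x _.
  apply: (@leq_trans (\sum_(y | adj x y) 2 * K)).
    apply: leq_sum => y /step[w wK ->]; apply: leq_trans (wall_dist_word _ _) _.
    by rewrite leq_mul2l.
  rewrite sum_nat_const leq_mul2r; apply/orP; right.
  rewrite (leq_trans _ (XD x)) // subset_leq_card //.
  by apply/fintype.subsetP => y; rewrite inE.
have S3 : c * (\sum_e #|B e| * #|(~: B e)%SET|)%:R <=
    #|X|%:R * (\sum_e #|edge_boundary (B e)|)%:R.
  rewrite !natr_sum !mulr_sumr; apply: ler_sum => e _.
  by rewrite natrM mulrA; exact: cheeger_cut.
rewrite S1 natrM mulrCA.
apply: (@le_trans _ _ (2 * (#|X|%:R * (#|X| * (D * (2 * K)))%:R))).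
  rewrite ler_pM2l //; apply: le_trans S3 _; rewrite ler_wpM2l // ler_nat //.
by rewrite !natrM; lra.
Qed.

(** Half of the vertices are within a bounded number of walls of one vertex,
    hence have their linear parts in a ball of bounded radius. *)
Lemma linear_concentration : exists m : nat, forall n (X : graph) (phi : X -> level n),
  coarse_map phi -> exists p, (#|X| <= 2 * 4 ^ m * #|[set x | (phi x).2.2 == p]%SET|)%N.
Proof.
(* Twice the bound on the mean in [sum_wall_dist], so that at most half of the vertices are
   beyond it; the summand 1 makes it positive. *)
pose L : R := (8 * K * D)%:R + 1.
pose m := (Num.truncn (L / c)).+1.
have mc : L <= c * m%:R by rewrite -ler_pdivrMl // mulrC ltW // truncnS_gt.
exists m => n X phi phiC; have [X0 XD cX words step] := phiC.
have X0' : 0 < #|X|%:R :> R by rewrite ltr0n.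
have [x0 hx0] : exists x0,
    c * (\sum_y wall_dist (phi x0) (phi y))%:R <= (4 * K * D)%:R * #|X|%:R.
  apply: contrapT => no; have := sum_wall_dist phiC; rewrite leNgt => /negP; apply.
  rewrite natr_sum mulr_sumr expr2 mulrA [ltLHS]mulr_natr -sumr_const.
  have [z _] : {z : X | true} by have /card_gt0P/sigW[z _] := X0; exists z.
  apply: ltr_sum; first by apply/hasP; exists z; rewrite ?mem_index_enum.
  by move=> x _; rewrite ltNge; apply/negP => h; apply: no; exists x.
pose near := [set y | (wall_dist (phi x0) (phi y) <= m)%N]%SET.
have card_near : (#|X| <= 2 * #|near|)%N.
  have far : L * #|(~: near)%SET|%:R <= (4 * K * D)%:R * #|X|%:R.
    apply: le_trans hx0; apply: (@le_trans _ _ (c * m%:R * #|(~: near)%SET|%:R)).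
      by rewrite ler_wpM2r.
    rewrite -mulrA ler_pM2l // -natrM ler_nat mulnC -sum_nat_const.
    rewrite [leqRHS](bigID [in (~: near)%SET]) /= -[leqLHS]addn0 leq_add //.
    by apply: leq_sum => y; rewrite !inE -ltnNge => /ltnW.
  have cardE : #|near|%:R + #|(~: near)%SET|%:R = #|X|%:R :> R by rewrite -natrD finset.cardsC.
  rewrite -(ler_nat R) natrM; have L1 : 1 <= L by rewrite lerDr.
  have kd : (4 * K * D)%:R * 2 <= L by rewrite /L -natrM mulnC !mulnA lerDl.
  have : L * #|(~: near)%SET|%:R * 2 <= L * #|X|%:R.
    apply: (@le_trans _ _ ((4 * K * D)%:R * #|X|%:R * 2)); first by rewrite ler_pM2r.
    by rewrite mulrAC ler_pM2r.
  by rewrite -mulrA ler_pM2l ?(lt_le_trans ltr01) // -cardE; lra.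
pose Z p : {set X} := [set x | (phi x).2.2 == p]%SET.
pose P := ball (move_perm n) m.
case: (@arg_maxnP {perm plane n} (1%g : {perm plane n}) xpredT
  (fun p => #|Z p|) isT) => p _ pmax.
exists p; apply: leq_trans card_near _; rewrite -mulnA leq_mul2l /=.
have cardP : (#|P| <= 4 ^ m)%N.
  by apply: leq_trans (card_ball _ _) _; rewrite card_option card_bool.
apply: leq_trans (_ : #|P| * #|Z p| <= _)%N; last by rewrite leq_mul2r cardP orbT.
apply: (@leq_trans (\sum_(b in P) #|Z ((phi x0).2.2 * b)%g|)); last first.
  by rewrite -sum_nat_const; apply: leq_sum => b _; exact: pmax.
apply: (@leq_trans #|(\bigcup_(b in P) Z ((phi x0).2.2 * b)%g)%SET|); last first.
  elim/big_ind2: _ => [|A a B b Aa Bb|//]; first by rewrite cards0.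
  by apply: leq_trans (leq_card_setU _ _) _; exact: leq_add.
apply/subset_leq_card/fintype.subsetP => y; rewrite inE => yn.
have [v vE] := words x0; have [w wE] := words y.
have [u us uE] := @wall_path n v w.
apply/bigcupP; exists (\prod_(s <- u) move_perm n s)%g.
  by apply: ball_word; apply: leq_trans us _; move: yn; rewrite /wall_dist vE wE.
by rewrite inE wE vE /eval uE.
Qed.

End ExpanderIntoLevel.

Section ExpanderFibre.
Variables (R : realType) (K D : nat) (c : R).
Hypothesis c0 : 0 < c.

Lemma neighbourhood_word n (X : graph) (phi : X -> level n) : coarse_map K D c phi ->
  forall k (B : {set X}) y, y \in iter k (@neighbourhood X) B ->
  exists2 x, x \in B & exists2 w, (size w <= K * k)%N & phi y = (phi x * eval level_gen n w)%g.
Proof.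
move=> [_ _ _ _ step]; elim=> [|k IHk] B y /=.
  by move=> yB; exists y => //; exists [::]; rewrite // /eval big_nil mulg1.
rewrite finset.in_setU => /orP[/IHk[x xB [w wk yx]]|].
  by exists x => //; exists w; rewrite // mulnS (leq_trans wk) // leq_addl.
rewrite inE => /existsP[z /andP[/IHk[x xB [w wk zx]] /step[v vK yz]]].
exists x => //; exists (w ++ v); first by rewrite size_cat mulnS addnC leq_add.
by rewrite eval_cat mulgA -zx.
Qed.

(** The linear parts concentrate; on a fibre of the linear part, short steps
    generate a subgroup of bounded order, and its cosets are too far apart for
    an expander to spread over several of them. *)
Theorem expander_fibre : exists2 eps : R, 0 < eps &
  forall n (X : graph) (phi : X -> level n), coarse_map K D c phi ->
  exists g, eps * #|X|%:R <= #|[set x | phi x == g]%SET|%:R.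
Proof.
have [m concentration] := linear_concentration K D c0.
(* The fibre of [linear_concentration] has proportion at least [3 * eta]. *)
pose eta : R := ((6 * 4 ^ m)%:R)^-1.
have eta0 : 0 < eta by rewrite invr_gt0 ltr0n muln_gt0 expn_gt0.
have ce0 : 0 < c * eta ^+ 2 by rewrite mulr_gt0 // exprn_gt0.
pose r := (Num.truncn (D%:R / (c * eta ^+ 2))).+1.
have rD : D%:R < r%:R * (c * eta ^+ 2) by rewrite -ltr_pdivrMr // truncnS_gt.
pose N := (2 ^ (6 ^ (K * r)))%N.
have N0 : 0 < N%:R :> R by rewrite ltr0n expn_gt0.
exists (eta / N%:R) => [|n X phi phiC]; first by rewrite divr_gt0.
have [X0 XD cX words step] := phiC.
have X0' : 0 < #|X|%:R :> R by rewrite ltr0n.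
apply: contrapT => no.
have fibre g : #|[set x | phi x == g]%SET|%:R <= eta / N%:R * #|X|%:R.
  by rewrite leNgt; apply/negP => h; apply: no; exists g; exact: ltW.
have [p hp] := concentration n X phi phiC.
pose Z := [set x | (phi x).2.2 == p]%SET.
have hZ : 3 * (eta * #|X|%:R) <= #|Z|%:R.
  rewrite mulrCA ler_pdivrMl ?ltr0n ?muln_gt0 ?expn_gt0 // -!natrM ler_nat.
  by rewrite -[(6 * 4 ^ m)%N]/(3 * 2 * 4 ^ m)%N -!mulnA leq_mul2l mulnA.
pose T := [set t in ball (level_gen n) (K * r) | t.2.2 == 1%g]%SET.
have Tword t : t \in T -> exists2 w, t = (\prod_(i <- w) level_gen n i)%g & t.2.2 = 1%g.
  by rewrite inE => /andP[/word_ball[w _ ->] /eqP t1]; exists w.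
pose U := <<T>>%G.
have cardU : (#|U| <= N)%N.
  apply: (@leq_trans (2 ^ #|T|)).
    apply: card_generated_involutions.
      by move=> s t /Tword[v -> s1] /Tword[w -> t1]; exact: kernel_comm.
    by move=> s /Tword[v -> s1]; exact: kernel_invol.
  rewrite leq_exp2l //; apply: (@leq_trans #|ball (level_gen n) (K * r)|).
    by apply/subset_leq_card/fintype.subsetP => t; rewrite inE => /andP[].
  by apply: leq_trans (card_ball _ _) _; rewrite card_generator.
pose f x := (phi x *: U)%g.
pose w (C : {set level n}) : R := #|[set x in Z | f x == C]%SET|%:R.
have wE C : w C = \sum_(x in Z | f x == C) 1.
  by rewrite /w -sum1_card natr_sum; apply: eq_bigl => x; rewrite !inE.
have w_small C : 0 <= w C <= eta * #|X|%:R.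
  rewrite ler0n /=; have [E0|[x]] := set_0Vmem [set x in Z | f x == C]%SET.
    by rewrite /w E0 cards0 mulr_ge0 // ltW.
  rewrite inE => /andP[xZ /eqP xC].
  apply: (@le_trans _ _ (\sum_(g in C) #|[set x | phi x == g]%SET|%:R)).
    rewrite -natr_sum ler_nat.
    apply: (@leq_trans #|(\bigcup_(g in C) [set x | phi x == g])%SET|).
      apply/subset_leq_card/fintype.subsetP => y; rewrite inE => /andP[_ /eqP yC].
      by apply/bigcupP; exists (phi y); rewrite ?inE // -yC lcoset_refl.
    elim/big_ind2: _ => [|A a B b Aa Bb|//]; first by rewrite cards0.
    by apply: leq_trans (leq_card_setU _ _) _; exact: leq_add.
  apply: le_trans (ler_sum _ (fun g _ => fibre g)) _.
  rewrite sumr_const -xC card_lcoset -[_ *+ #|U|]mulr_natl.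
  have -> : eta * #|X|%:R = N%:R * (eta / N%:R * #|X|%:R) by field; rewrite gt_eqF.
  by rewrite ler_wpM2r ?ler_nat // mulr_ge0 // divr_ge0 // ltW.
have w_total : 3 * (eta * #|X|%:R) <= \sum_C w C.
  apply: le_trans hZ _; under eq_bigr do rewrite wE.
  by rewrite -sum1_card natr_sum (partition_big f xpredT).
have [P [PB PB']] := split_weights w_small w_total.
pose B := [set x in Z | f x \in P]%SET; pose B' := [set x in Z | f x \notin P]%SET.
have sumw (Q : {set {set level n}}) : \sum_(C in Q) w C = #|[set x in Z | f x \in Q]%SET|%:R.
  under eq_bigr do rewrite wE.
  rewrite -sum1_card natr_sum (partition_big f [in Q]) => [|x]; last by rewrite inE => /andP[].
  apply: eq_bigr => C CQ; apply: eq_bigl => x; rewrite inE.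
  by case: eqP => [->|]; rewrite ?CQ ?andbT ?andbF.
have hB : eta * #|X|%:R <= #|B|%:R by rewrite -sumw.
have hB' : eta * #|X|%:R <= #|B'|%:R.
  rewrite (_ : B' = [set x in Z | f x \in (~: P)%SET]%SET) -?sumw //.
  by apply/setP => x; rewrite !inE.
have grow : #|(~: iter r (@neighbourhood X) B)%SET|%:R < eta * #|X|%:R.
  rewrite ltNge; apply/negP => h.
  have := neighbourhood_growth c0 cX XD eta0 X0 hB h.
  by rewrite leNgt rD.
have [y yB' yB] : exists2 y, y \in B' & y \in iter r (@neighbourhood X) B.
  apply: contrapT => none; move: (lt_le_trans grow hB').
  rewrite ltr_nat ltnNge => /negP; apply.
  apply/subset_leq_card/fintype.subsetP => y yB'; rewrite inE; apply/negP => yB.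
  by apply: none; exists y.
have [x xB [u uK yx]] := neighbourhood_word phiC yB.
move: xB yB'; rewrite !inE => /andP[/eqP xp xP] /andP[/eqP yp] /negP; apply.
suff -> : f y = f x by [].
apply/lcoset_eqP; rewrite mem_lcoset yx mulKg; apply: mem_gen; rewrite inE ball_word //=.
have : (phi y).2.2 = ((phi x).2.2 * (eval level_gen n u).2.2)%g by rewrite yx.
by rewrite xp yp -[LHS]mulg1 => /mulgI <-.
Qed.

End ExpanderFibre.

(** * Weakly embedded expanders *)

Lemma graph_dist_adj (X : graph) (x y : X) : adj x y -> (graph_dist x y <= 1)%N.
Proof. by move=> xy; apply: (leastP _).2; exists [:: y]; rewrite /= xy. Qed.

(** Points with the same image are at distance less than 1. *)
Lemma weak_embedding_fibre (R : realType) (X : nat -> finType)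
    (dX : forall n, X n -> X n -> R) (Y : Type) (dY : Y -> Y -> R) (phi : forall n, X n -> Y) :
  (forall u, dY u u = 0) -> (forall n, (0 < #|X n|)%N) -> weak_embedding dX dY phi ->
  forall eps : R, 0 < eps -> \forall n \near \oo, forall u,
    #|[set x | `[< phi n x = u >]]%SET|%:R < eps * #|X n|%:R.
Proof.
move=> d0 X0 [_ /(_ 1 ltr01) small] eps eps0; near=> n => u.
have Xn0 : 0 < #|X n|%:R :> R by rewrite ltr0n.
have [E0|[z]] := set_0Vmem [set x | `[< phi n x = u >]]%SET.
  by rewrite E0 cards0 mulr_gt0.
rewrite inE => /asboolP zu; rewrite -ltr_pdivrMr //.
apply: (@le_lt_trans _ _ (\big[Order.max/0]_(x : X n)
    (#|[set y | dY (phi n x) (phi n y) < 1]%SET|%:R / #|X n|%:R : R))).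
  apply: le_trans (le_bigmax _ _ z); rewrite ler_pM2r ?invr_gt0 // ler_nat.
  apply/subset_leq_card/fintype.subsetP => x; rewrite !finset.inE => /asboolP xu.
  by rewrite zu xu d0.
apply: le_lt_trans (ler_norm _) _; rewrite -normrN -sub0r; near: n.
by apply: (@cvgrPdist_lt _ _ _ _ _ _ _).1.
Unshelve. all: end_near. Qed.

Lemma box_union_finite m : finite_set [set u : box_union box | (projT1 u < m)%N].
Proof.
apply: (@sub_finite_set _ _ (\bigcup_(k in [set k | (k < m)%N])
    (existT (box_piece box) k @` [set: box_piece box k]))).
  by move=> [k x] /= km; exists k => //; exists x.
apply: bigcup_finite; first exact: finite_II.
by move=> k _; apply: finite_image; exact: (box_chain_index box k).
Qed.

(** An expander is connected and the pieces are far apart, so it is sent either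
    to finitely many points or into a single piece; in both cases a fibre is
    large. *)
Theorem box_no_expander (R : realType) : ~ admits_weakly_embedded_expander R box.
Proof.
case=> d [[dxx dC dtri] dpiece dfar] [X [Xconn [D XD] _ [c c0 cX]] [phi emb]].
have X0 n : (0 < #|X n|)%N by have [] := Xconn n.
have dist0 u : d u u = 0 by apply/dxx.
have small := weak_embedding_fibre dist0 X0 emb.
have [[K K0 lip] _] := emb.
have step n (x y : X n) : adj x y -> d (phi n x) (phi n y) <= K.
  move=> xy; apply: le_trans (lip n x y) _; rewrite -[leRHS]mulr1 ler_pM2l //.
  by rewrite -[leRHS]/(1%:R) ler_nat graph_dist_adj.
have [n0 far] := dfar (K + 1); pose n1 := maxn n0 1.
have [s sE] := (finite_seqP _).1 (box_union_finite n1).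
have [eps eps0 fibre] := expander_fibre (Num.truncn K) D c0.
pose e := Num.min eps (2 * (size s).+1%:R)^-1.
have e0 : 0 < e by rewrite lt_min eps0 invr_gt0 mulr_gt0.
have [n /= hn] := filter_ex (small e e0).
have X0' : 0 < #|X n|%:R :> R by rewrite ltr0n.
have [[x0 tag_x0]|low] := pselect (exists x, (n1 <= projT1 (phi n x))%N).
  pose m := projT1 (phi n x0).
  have closed_tag y z : adj y z -> projT1 (phi n y) = m -> projT1 (phi n z) = m.
    move=> /step yz ym; apply: contrapT => /eqP zm.
    have apart (u v : box_union box) : projT1 u = m -> projT1 v != m -> K + 1 <= d u v.
      case: u v => [k x] [l y'] /= km lm; apply: far; first by rewrite km eq_sym.
      rewrite km; apply: leq_trans (leq_maxl _ _); apply: leq_trans tag_x0.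
      exact: leq_maxl.
    by have := le_trans (apart _ _ ym zm) yz; rewrite gerDl ler10.
  have all_tag y : projT1 (phi n y) = m.
    have /connectP[p pP ->] := (Xconn n).2 x0 y.
    have path_tag z : projT1 (phi n z) = m -> path (@adj (X n)) z p ->
        projT1 (phi n (last z p)) = m.
      elim: p z {pP} => //= v p IHp z zm /andP[zv]; apply: IHp.
      exact: closed_tag zv zm.
    exact: path_tag pP.
  have [k mk] : exists k, m = k.+1.
    by exists m.-1; rewrite prednK //; apply: leq_trans tag_x0; exact: leq_maxr.
  have piece_of y : exists x : box_piece box k.+1, phi n y = existT _ k.+1 x.
    by have := all_tag y; rewrite mk; case: (phi n y) => l x /= lk; case: _ / lk; exists x.
  have [g gE] := choice piece_of.
  pose psi y : level k := piece_value (g y).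
  have psiC : coarse_map (Num.truncn K) D c psi.
    split; [exact: X0|exact: XD|exact: cX|by move=> y; exact: eval_piece|].
    move=> y z /step; rewrite !gE dpiece => yz.
    have [w wE zE] := piece_dist_word (g y) (g z).
    by exists w => //; rewrite wE truncn_ge_nat // ltW.
  have [a] := fibre k (X n) psi psiC; apply/negP; rewrite -ltNge.
  have [E0|[z]] := set_0Vmem [set x | psi x == a]%SET.
    by rewrite E0 cards0 mulr_gt0.
  rewrite finset.inE => /eqP za; apply: (@lt_le_trans _ _ (e * #|X n|%:R)).
    apply: le_lt_trans (hn (phi n z)); rewrite ler_nat.
    apply/subset_leq_card/fintype.subsetP => x; rewrite !finset.inE => /eqP xa.
    apply/asboolP; rewrite !gE; congr existT; apply: piece_value_inj.
    by rewrite -/(psi x) -/(psi z) xa za.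
  by rewrite ler_pM2r // ge_min lexx.
have in_s x : phi n x \in s.
  have : [set` s] (phi n x) by rewrite -sE /= ltnNge; apply/negP => h; apply: low; exists x.
  by [].
have : #|X n|%:R <= (size s)%:R * (e * #|X n|%:R).
  apply: (@le_trans _ _ (\sum_(u <- s) #|[set x | `[< phi n x = u >]]%SET|%:R)).
    rewrite -natr_sum ler_nat -sum1_card.
    under [leqRHS]eq_bigr do rewrite -sum1_card big_mkcond.
    rewrite exchange_big /=; apply: leq_sum => x _.
    rewrite (big_rem _ (in_s x)) /= finset.inE ifT ?leq_addr //; exact/asboolP.
  apply: le_trans (ler_sum _ (fun u _ => ltW (hn u))) _.
  by rewrite big_const_seq count_predT iter_addr_0 mulr_natl.
apply/negP; rewrite -ltNge mulrA gtr_pMl //.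
have e_small : e <= (2 * (size s).+1%:R)^-1 by rewrite ge_min lexx orbT.
apply: le_lt_trans (ler_wpM2l (ler0n _ (size s)) e_small) _.
rewrite ltr_pdivrMr ?mulr_gt0 // mul1r -natr1.
by have := ler0n R (size s); lra.
Unshelve. all: end_near. Qed.

Theorem theorem1 (R : realType) :
  exists (G : groupType) (Y : box_space G),
    [/\ finitely_generated G,
        residually_finite G,
        forall (p : R) (p1 : (1 <= p%:E)%E) (d : measure_display)
          (Om : measurableType d) (mu : {measure set Om -> \bar R}),
          ~ coarsely_embeds (@box_dist R G Y) (@Lp_dist R d Om mu p%:E p1),
        forall X : completeNormedModType R, uniformly_curved X ->
          ~ coarsely_embeds (@box_dist R G Y) (@norm_dist R X) &
        ~ admits_weakly_embedded_expander R Y].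
Proof.
exists _, box; split.
- exact: word_group_finitely_generated.
- exact: word_group_residually_finite.
- exact: box_not_in_Lp.
- exact: box_not_in_curved.
- exact: box_no_expander.
Qed.
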